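(* Let $\mathsf{F}$ be a field, let $n$ and $k$ be positive integers, and let $S$ be a finite nonempty subset of $\mathsf{F}$. Let $\varphi$ be any one of the three operators $\varphi_T,\varphi_H,\varphi_{TH}$ on $\mathsf{F}^{n\times n}$ defined in the context. One can check whether a black-box matrix $A\in\mathsf{F}^{n\times n}$ is Toeplitz-like (for $\varphi=\varphi_T$), Hankel-like (for $\varphi=\varphi_H$), or Toeplitz+Hankel-like (for $\varphi=\varphi_{TH}$), with displacement rank at most $k$, that is, whether $\operatorname{rank}\varphi(A)\le k$, and return a representation of the operator matrix $\varphi(A)$ allowing a superfast algorithm to be applied to $A$ if this is the case. The costs and failure probabilities are as follows. (1) The check selects $\Theta(nk)$ values uniformly and independently from $S$ and performs $\Theta(nk^2+\mu k\log n)$ arithmetic operations in $\mathsf{F}$ and $\Theta(n\log_2 n)$ operations on bits. It fails with probability at most $(\min(r,k)+1)/|S|$, where $r=\operatorname{rank}\varphi(A)$ is the displacement rank of $A$, and only by returning an estimate of the displacement rank that is too low. (2) If $r\le k$, then the representation of the operator matrix, namely a decomposition $$\varphi(A)=P\cdot\begin{bmatrix} I_r\\ L\end{bmatrix}\cdot C\cdot\begin{bmatrix} I_r & R\end{bmatrix}\cdot Q$$ with $P,Q\in\mathsf{F}^{n\times n}$ permutation matrices, $L\in\mathsf{F}^{(n-r)\times r}$, $R\in\mathsf{F}^{r\times(n-r)}$ and $C\in\mathsf{F}^{r\times r}$ nonsingular, can be computed at the cost given in (1) and returned as a certificate. This certificate can be verified by choosing $n$ values uniformly and independently from $S$ and performing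 $\Theta(nk+\mu)$ arithmetic operations in $\mathsf{F}$ and $\Theta(n\log_2 n)$ operations on bits. If the certificate is correct then it is accepted with certainty; otherwise it is accepted with probability at most $1/|S|$.
   Context: For $\alpha\in\mathsf{F}$, $Z_\alpha\in\mathsf{F}^{n\times n}$ is the matrix whose entry in row $i+1$ and column $i$ is $1$ for $1\le i\le n-1$, whose entry in row $1$ and column $n$ is $\alpha$, and all of whose other entries are zero. The operators are $$\varphi_T(A)=Z_1A-AZ_0,\qquad \varphi_H(A)=Z_1A-AZ_0^T,\qquad \varphi_{TH}(A)=(Z_0+Z_0^T)A-A(Z_0+Z_0^T).$$ $A$ is Toeplitz-like (respectively Hankel-like, Toeplitz+Hankel-like) if the rank of $\varphi_T(A)$ (respectively $\varphi_H(A)$, $\varphi_{TH}(A)$) is small relative to $n$. The matrix $\varphi_T(A)$ (respectively $\varphi_H(A)$, $\varphi_{TH}(A)$) is called the operator matrix and its rank is the displacement rank of $A$. ''Superfast algorithms'' are the known algorithms for structured matrices whose input is such a low-rank representation of the operator matrix. Black-box model: $A$ is accessed only through multiplication of $A$ or $A^T$ by vectors. $\mu$ denotes the number of operations in $\mathsf{F}$ required to multiply either $A$ or $A^T$ by a given vector in $\mathsf{F}^{n\times 1}$; it is assumed that $n\le\mu\le n(2n+1)$. The decomposition is for positive displacement rank $r$; if the reported displacement rank is $0$, the certificate is the claim that $\varphi(A)=0$. A certificate is correct if the stated equality for $\varphi(A)$ holds (respectively if $\varphi(A)=0$). Permutation matrices are represented as integer vectors of length $n$ whose $i$th entry is the index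 of the nonzero entry in row $i$. The certificate is produced by one party (the prover) and checked by another (the verifier), who has black-box access to $A$. *)

(* Defs.v *)
From HB Require Import structures.
From mathcomp Require Import all_boot all_order all_algebra.
From mathcomp Require Import finmap.

Set Implicit Arguments.
Unset Strict Implicit.
Unset Printing Implicit Defensive.

Import Order.TTheory GRing.Theory Num.Theory.
Local Open Scope ring_scope.

(** * Displacement operators (rows and columns are numbered from 0) *)

Definition Zmx (F : fieldType) (n : nat) (alpha : F) : 'M[F]_n :=
  \matrix_(i, j)
    if i == j.+1 :> nat then 1
    else if (i == 0 :> nat) && (j == n.-1 :> nat) then alpha else 0.

Inductive displacement := ToeplitzLike | HankelLike | ToeplitzHankelLike.

Definition operator_matrix (op : displacement) (F : fieldType) (n : nat)
    (A : 'M[F]_n) : 'M[F]_n :=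
  let Z0 := Zmx n 0 in
  let Z1 := Zmx n 1 in
  match op with
  | ToeplitzLike => Z1 *m A - A *m Z0
  | HankelLike => Z1 *m A - A *m Z0^T
  | ToeplitzHankelLike => (Z0 + Z0^T) *m A - A *m (Z0 + Z0^T)
  end.

(** * Low-rank representations of the operator matrix *)

(* [rep_p] and [rep_q] are the integer vectors standing for P and Q.  They are
   arbitrary integers, as a dishonest prover may send vectors that do not
   represent permutations. *)
Record representation (F : fieldType) (n r : nat) := Representation {
  rep_p : 'I_n -> nat;
  rep_q : 'I_n -> nat;
  rep_L : 'M[F]_(n - r, r);
  rep_C : 'M[F]_r;
  rep_R : 'M[F]_(r, n - r)
}.

Definition index_mx (F : fieldType) (n : nat) (p : 'I_n -> nat) : 'M[F]_n :=
  \matrix_(i, j) (p i == j :> nat)%:R.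

Definition rep_value (F : fieldType) (n r : nat) (le_rn : (r <= n)%N)
    (c : representation F n r) : 'M[F]_n :=
  index_mx F (rep_p c)
  *m castmx (subnKC le_rn, erefl r) (col_mx 1%:M (rep_L c))
  *m rep_C c
  *m castmx (erefl r, subnKC le_rn) (row_mx 1%:M (rep_R c))
  *m index_mx F (rep_q c).

(* The certificate for a reported displacement rank r, as a claim about the
   operator matrix B.  Nonsingularity of C is not part of the equality claimed
   for B; it is required separately of the certificates that are computed. *)
Definition correct_certificate (F : fieldType) (n r : nat) (le_rn : (r <= n)%N)
    (B : 'M[F]_n) (c : representation F n r) : bool :=
  if r == 0%N then B == 0
  else [&& is_perm_mx (index_mx F (rep_p c)), is_perm_mx (index_mx F (rep_q c))
         & B == rep_value le_rn c].

(** * Black-box algorithms *)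

(* Registers are the entries (t, i, j) -- array t, row i, column j -- of
   countably many two-dimensional arrays.  There is one such bank of registers
   for elements of F and one for bits. *)
Definition reg : Set := (nat * nat * nat)%type.

Inductive field_op := FAdd | FSub | FMul | FDiv.

(* Algebraic computation trees with access to a black box of order n and to a
   source of random field elements; a leaf carries a value of type X.  A tree
   does not mention F or A, and the only information about field elements and
   bits that can influence the control flow is what zero tests and bit tests
   reveal.  Loop control and address computations are encoded in the shape of
   the tree and hence are not charged for.  Quotients follow the MathComp
   convention x / 0 = 0.
   [BlackBox tr (t, j) (t', j') _] replaces the first n entries of column j' of
   array t' by the product of A (of its transpose if tr) and the vector made of
   the first n entries of column j of array t. *)
Inductive prog (n : nat) (X : Type) : Type :=
| Return of X
| FieldConst of bool & reg & prog n X
| FieldOp of field_op & reg & reg & reg & prog n X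
| FieldTest of reg & prog n X & prog n X
| FieldDraw of reg & prog n X
| BlackBox of bool & nat * nat & nat * nat & prog n X
| BitOp of (bool -> bool -> bool) & reg & reg & reg & prog n X
| BitTest of reg & prog n X & prog n X.

Record state (F : fieldType) := State { freg : reg -> F; breg : reg -> bool }.

Record outcome (F : fieldType) (X : Type) := Outcome {
  leaf : X;
  final : state F;
  arith_ops : nat;
  bit_ops : nat;
  draws : nat
}.

Section Run.
Variables (F : fieldType) (n : nat) (X : Type).
Implicit Types (st : state F) (o : outcome F X).

Definition set_freg st (d : reg) (x : F) : state F :=
  State (fun a => if a == d then x else freg st a) (breg st).

Definition set_breg st (d : reg) (b : bool) : state F :=
  State (freg st) (fun a => if a == d then b else breg st a).

Definition get_column st (src : nat * nat) : 'cV[F]_n :=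
  \col_i freg st (src.1, val i, src.2).

Definition set_column st (dst : nat * nat) (v : 'cV[F]_n) : state F :=
  State
    (fun a : reg =>
       let: (t, i, j) := a in
       if (t, j) == dst then
         if insub i is Some i' then v (i' : 'I_n) 0 else freg st a
       else freg st a)
    (breg st).

Definition eval_op (f : field_op) (x y : F) : F :=
  match f with
  | FAdd => x + y
  | FSub => x - y
  | FMul => x * y
  | FDiv => x / y
  end.

Definition charge (a b d : nat) o : outcome F X :=
  Outcome (leaf o) (final o)
    (a + arith_ops o)%N (b + bit_ops o)%N (d + draws o)%N.

(* [mu] is the number of operations charged for a use of the black box, and
   [tape] supplies the values of the successive draws.  The default value 0 is
   read past its end, which is harmless when [draws] is at most [size tape]. *)
Fixpoint run (A : 'M[F]_n) (mu : nat) (p : prog n X) st (tape : seq F)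
    : outcome F X :=
  match p with
  | Return x => Outcome x st 0 0 0
  | FieldConst b d p' =>
      charge 1 0 0 (run A mu p' (set_freg st d b%:R) tape)
  | FieldOp f d x y p' =>
      charge 1 0 0
        (run A mu p' (set_freg st d (eval_op f (freg st x) (freg st y))) tape)
  | FieldTest x p0 p1 =>
      charge 1 0 0 (run A mu (if freg st x == 0 then p0 else p1) st tape)
  | FieldDraw d p' =>
      charge 0 0 1 (run A mu p' (set_freg st d (head 0 tape)) (behead tape))
  | BlackBox tr src dst p' =>
      charge mu 0 0
        (run A mu p'
           (set_column st dst ((if tr then A^T else A) *m get_column st src))
           tape)
  | BitOp f d x y p' =>
      charge 0 1 0
        (run A mu p' (set_breg st d (f (breg st x) (breg st y))) tape)
  | BitTest x p0 p1 =>
      charge 0 1 0 (run A mu (if breg st x then p1 else p0) st tape)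
  end.

End Run.

(** * Certificates in memory *)

(* An index between 0 and n - 1 takes [up_log 2 n], the ceiling of log_2 n,
   bits, least significant bit first. *)
Definition read_index (F : fieldType) (n : nat) (st : state F) (t i : nat) : nat :=
  (\sum_(b < up_log 2 n) breg st (t, i, val b) * 2 ^ b)%N.

(* Certificates are exchanged in bit arrays 0 and 1 (P and Q) and in field
   arrays 0, 1 and 2 (L, C and R).  The rank r determines the size of the
   message, so it is not itself stored. *)
Definition read_rep (F : fieldType) (n r : nat) (st : state F)
    : representation F n r :=
  Representation
    (fun i : 'I_n => read_index n st 0 i)
    (fun i : 'I_n => read_index n st 1 i)
    (\matrix_(i, j) freg st (0%N, val i, val j))
    (\matrix_(i, j) freg st (1%N, val i, val j))
    (\matrix_(i, j) freg st (2%N, val i, val j)).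

(** * Specification of the check *)

Definition reported_rank (n k : nat) := 'I_(minn n k).+1.

Lemma reported_rank_le (n k : nat) (r : reported_rank n k) : (r <= n)%N.
Proof. exact: leq_trans (leq_ord r) (geq_minl n k). Qed.

(* [None] reports that the displacement rank exceeds k. *)
Definition check_succeeds (F : fieldType) (n k : nat) (B : 'M[F]_n)
    (o : outcome F (option (reported_rank n k))) : bool :=
  if leaf o is Some r then
    let c := read_rep n r (final o) in
    [&& r == \rank B :> nat,
        correct_certificate (reported_rank_le r) B c & rep_C c \in unitmx]
  else (k < \rank B)%N.

Definition estimate_too_low (F : fieldType) (n k : nat) (B : 'M[F]_n)
    (o : outcome F (option (reported_rank n k))) : bool :=
  if leaf o is Some r then (r < \rank B)%N else false.

(** * Probabilities and orders of growth *)

(* The probability of E when N values are chosen uniformly and independently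
   from S. *)
Definition prob (F : fieldType) (S : {fset F}) (N : nat) (E : seq F -> bool)
    : rat :=
  #|[set t : N.-tuple S | E [seq val s | s <- t]]|%:R / #|{: N.-tuple S}|%:R.

(* x is within the constant factor c of f.  In bounds, log_2 n is rendered by
   [up_log 2 n]: both vanish at n = 1, and
   log_2 n <= up_log 2 n <= 2 log_2 n for n >= 2. *)
Definition Theta (c f x : nat) : bool := (f <= c * x)%N && (x <= c * f)%N.

(* Main.v *)
Require Import Defs.
From mathcomp Require Import all_boot all_order all_fingroup all_algebra.
From mathcomp Require Import finmap.
From mathcomp Require Import zify ring.

Set Implicit Arguments.
Unset Strict Implicit.
Unset Printing Implicit Defensive.

Import GRing.Theory Num.Theory.
Local Open Scope ring_scope.

(**
Multiplying the operator matrix B by n x (k+1) random entries U costs O(k)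
black-box products, and B U has rank min(r, k+1) unless, for some column of U,
a nonzero linear form in its entries vanishes while the previous columns do not
yet span enough; each of these min(r, k+1) events has probability at most
1/|S|.  Gauss-Jordan elimination on the columns of B U yields pivot rows I and a
matrix E with the same column space and with E_I = 1.  If B U has the rank of B,
then B = E B_I; the rows B_I are obtained from k products with B^T, and a second
elimination gives pivot columns J and a matrix G with G_J = 1 and
B = E B_{I,J} G^T, which is the required decomposition once the pivots are
moved to the front.  The rank found is never too high, so the only possible
error is an estimate that is too low.

For the certificate, the product of B minus the claimed matrix with a random
vector vanishes with probability at most 1/|S| when the claim is wrong.

Neither algorithm needs as many operations as the lower bounds in the
statement require (in particular no log n factor for the black box), so both
are padded with idle operations.
*)

(** * Sequential composition and loops *)

Section Combinators.
Variable n : nat.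

Fixpoint bind X Y (p : prog n X) (f : X -> prog n Y) : prog n Y :=
  match p with
  | Return x => f x
  | FieldConst b d p' => FieldConst b d (bind p' f)
  | FieldOp g d x y p' => FieldOp g d x y (bind p' f)
  | FieldTest x p0 p1 => FieldTest x (bind p0 f) (bind p1 f)
  | FieldDraw d p' => FieldDraw d (bind p' f)
  | BlackBox tr src dst p' => BlackBox tr src dst (bind p' f)
  | BitOp g d x y p' => BitOp g d x y (bind p' f)
  | BitTest x p0 p1 => BitTest x (bind p0 f) (bind p1 f)
  end.

Fixpoint loop I (s : seq I) (body : I -> prog n unit) : prog n unit :=
  if s is i :: s' then bind (body i) (fun=> loop s' body) else Return n tt.

Fixpoint mapM I Y (f : I -> prog n Y) (s : seq I) : prog n (seq Y) :=
  if s is i :: s' then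
    bind (f i) (fun y => bind (mapM f s') (fun ys => Return n (y :: ys)))
  else Return n [::].

End Combinators.

Lemma drop_behead T d (s : seq T) : drop d (behead s) = drop d.+1 s.
Proof. by rewrite -drop1 drop_drop addn1. Qed.

Lemma run_bind (F : fieldType) n X Y (A : 'M[F]_n) mu (p : prog n X)
    (f : X -> prog n Y) st tape :
  let o := run A mu p st tape in
  run A mu (bind p f) st tape
  = charge (arith_ops o) (bit_ops o) (draws o)
      (run A mu (f (leaf o)) (final o) (drop (draws o) tape)).
Proof.
have chargeA a b d a' b' d' o : charge a b d (charge a' b' d' o)
    = charge (a + a') (b + b') (d + d') o :> outcome F Y.
  by rewrite /charge /= !addnA.
elim: p st tape => [x|b d p IH|g d x y p IH|x p0 IH0 p1 IH1|d p IH
    |tr src dst p IH|g d x y p IH|x p0 IH0 p1 IH1] st tape /=.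
- by rewrite drop0; case: run.
- by rewrite IH chargeA /= !add0n.
- by rewrite IH chargeA.
- by case: ifP => _; rewrite ?IH0 ?IH1 chargeA.
- by rewrite IH chargeA drop_behead.
- by rewrite IH chargeA.
- by rewrite IH chargeA.
- by case: ifP => _; rewrite ?IH0 ?IH1 chargeA.
Qed.

Section Triples.
Variables (F : fieldType) (n : nat) (A : 'M[F]_n) (mu : nat).

(** Quantifying over all tapes confines this judgement to facts that hold whatever is drawn; the
    filling of a matrix with draws is therefore specified separately, with an explicit tape. *)
Definition tri X (p : prog n X) (st : state F) (Q : X -> state F -> Prop) :=
  forall tape, let o := run A mu p st tape in Q (leaf o) (final o).

Lemma tri_bind X Y (p : prog n X) (f : X -> prog n Y) st Q :
  tri p st (fun x st' => tri (f x) st' Q) -> tri (bind p f) st Q.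
Proof. by move=> H tape; rewrite /= run_bind; apply: H. Qed.

Lemma tri_mono X (p : prog n X) st (Q Q' : X -> state F -> Prop) :
  tri p st Q -> (forall x st', Q x st' -> Q' x st') -> tri p st Q'.
Proof. by move=> H QQ' tape; apply/QQ'/H. Qed.

(* The facts [P i] are meant to be insensitive to the order of the iterations,
   in the way single assignments are. *)
Lemma tri_loop (I : eqType) (s : seq I) (body : I -> prog n unit)
    (R : state F -> Prop) (P : I -> state F -> Prop) st :
  (forall i st', i \in s -> R st' -> tri (body i) st' (fun _ st'' =>
    [/\ R st'', P i st'' & forall i', P i' st' -> P i' st''])) ->
  R st ->
  tri (loop s body) st (fun _ st' => R st' /\ forall i, i \in s -> P i st').
Proof.
move=> Hb; suff H s' s0 : (forall i, i \in s' -> i \in s) ->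
    forall st', R st' -> (forall i, i \in s0 -> P i st') ->
    tri (loop s' body) st' (fun _ st'' =>
      R st'' /\ forall i, i \in s0 ++ s' -> P i st'').
  by move=> Rst; apply: (H s [::]).
elim: s' s0 => [|i s' IH] s0 sub st' Rst' P0.
  by move=> tape /=; rewrite cats0.
apply: tri_bind; apply: tri_mono (Hb i st' _ Rst') _.
  by rewrite sub ?mem_head.
move=> _ st'' [R'' Pi pres].
have -> : s0 ++ i :: s' = rcons s0 i ++ s' by rewrite cat_rcons.
apply: IH => // [j js|j]; first by rewrite sub // inE js orbT.
by rewrite mem_rcons inE => /orP [/eqP ->|/P0 /pres].
Qed.

Definition reads X (p : prog n X) (st : state F) (x : X) :=
  tri p st (fun x' st' => x' = x /\ st' = st).

Lemma reads_bind X Y (p : prog n X) (f : X -> prog n Y) st x Q :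
  reads p st x -> tri (f x) st Q -> tri (bind p f) st Q.
Proof.
move=> Hp Hf; apply: tri_bind; apply: tri_mono Hp _.
by move=> _ _ [-> ->].
Qed.

Lemma reads_mapM I X (f : I -> prog n X) (g : I -> X) s st :
  (forall i, reads (f i) st (g i)) -> reads (mapM f s) st (map g s).
Proof.
move=> H; elim: s => [|i s IH] //=.
by apply: reads_bind (H i) _; apply: reads_bind IH _.
Qed.

End Triples.

(** * Costs *)

(** Black-box uses are counted by [q] apart from the other operations, so one bound serves all [mu].
    Draws are counted exactly, since a continuation starts at a definite position of the tape. *)
Definition costs n X (p : prog n X) (a q b d : nat) :=
  forall (F : fieldType) (A : 'M[F]_n) mu st tape,
  let o := run A mu p st tape in
  [/\ (arith_ops o <= a + q * mu)%N, (bit_ops o <= b)%N & draws o = d].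

(** Exact counts make the padding yield lower bounds. *)
Definition costs_exactly n X (p : prog n X) (a q b d : nat) :=
  forall (F : fieldType) (A : 'M[F]_n) mu st tape,
  let o := run A mu p st tape in
  [/\ arith_ops o = (a + q * mu)%N, bit_ops o = b & draws o = d].

Section Costs.
Variable n : nat.

Lemma costs_exactlyW X (p : prog n X) a q b d :
  costs_exactly p a q b d -> costs p a q b d.
Proof. by move=> H F A mu st tape; have /= [-> -> ->] := H F A mu st tape. Qed.

Lemma costs_mono X (p : prog n X) a q b d a' q' b' :
  costs p a q b d -> (a <= a')%N -> (q <= q')%N -> (b <= b')%N ->
  costs p a' q' b' d.
Proof.
move=> H la lq lb F A mu st tape /=; have [ha hb ->] := H F A mu st tape.
split=> //; last exact: leq_trans lb.
by apply: leq_trans ha _; rewrite leq_add // leq_mul2r lq orbT.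
Qed.

Lemma costs_Return X (x : X) : costs (Return n x) 0 0 0 0.
Proof. by []. Qed.

Lemma costs_bind X Y (p : prog n X) (f : X -> prog n Y) a q b d a' q' b' d' :
  costs p a q b d -> (forall x, costs (f x) a' q' b' d') ->
  costs (bind p f) (a + a') (q + q') (b + b') (d + d').
Proof.
move=> Hp Hf F A mu st tape; rewrite /= run_bind /=.
have [ha hb ->] := Hp F A mu st tape.
set o := run A mu p st tape in ha hb *.
have [ha' hb' ->] := Hf (leaf o) F A mu (final o) (drop d tape).
by split=> //; lia.
Qed.

Lemma costs_exactly_bind X Y (p : prog n X) (f : X -> prog n Y)
    a q b d a' q' b' d' :
  costs_exactly p a q b d -> (forall x, costs_exactly (f x) a' q' b' d') ->
  costs_exactly (bind p f) (a + a') (q + q') (b + b') (d + d').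
Proof.
move=> Hp Hf F A mu st tape; rewrite /= run_bind /=.
have [-> -> ->] := Hp F A mu st tape.
set o := run A mu p st tape.
have [-> -> ->] := Hf (leaf o) F A mu (final o) (drop d tape).
by split=> //; rewrite mulnDl; lia.
Qed.

Lemma costs_loop I (s : seq I) (body : I -> prog n unit) a q b d :
  (forall i, costs (body i) a q b d) ->
  costs (loop s body) (size s * a) (size s * q) (size s * b) (size s * d).
Proof.
move=> H; elim: s => [|i s IH]; first exact: costs_Return.
by rewrite /= !mulSn; apply: costs_bind.
Qed.

Lemma costs_exactly_loop I (s : seq I) (body : I -> prog n unit) a q b d :
  (forall i, costs_exactly (body i) a q b d) ->
  costs_exactly (loop s body)
    (size s * a) (size s * q) (size s * b) (size s * d).
Proof.
move=> H; elim: s => [|i s IH]; first by [].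
by rewrite /= !mulSn; apply: costs_exactly_bind.
Qed.

Lemma costs_mapM I Y (f : I -> prog n Y) (s : seq I) a q b d :
  (forall i, costs (f i) a q b d) ->
  costs (mapM f s) (size s * a) (size s * q) (size s * b) (size s * d).
Proof.
move=> H; elim: s => [|i s IH]; first exact: costs_Return.
rewrite /= !mulSn; apply: costs_bind => // y.
by rewrite -[(_ * a)%N]addn0 -[(_ * q)%N]addn0 -[(_ * b)%N]addn0
  -[(_ * d)%N]addn0; apply: costs_bind.
Qed.

End Costs.

(** * Registers and arithmetic expressions *)

(** Field computations never write bits, so a frame preserves the whole bit bank, and certificates
    stored there survive. *)
Definition frame (F : fieldType) (P : pred nat) (st st' : state F) :=
  (forall t i j, ~~ P t -> freg st' (t, i, j) = freg st (t, i, j))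
  /\ breg st' = breg st.

Definition arr (F : fieldType) (st : state F) (t m s : nat) : 'M[F]_(m, s) :=
  \matrix_(i, j) freg st (t, val i, val j).

(* Array 3 holds intermediate results; arrays 0, 1 and 2 hold certificates. *)
Definition above (b : nat) : pred nat := fun t => (t == 3) || (b <= t)%N.
Definition only (b : nat) : pred nat := fun t => (t == 3) || (t == b).

Section Frames.
Variable F : fieldType.
Implicit Types st : state F.

Lemma frame_trans P st1 st2 st3 :
  frame P st1 st2 -> frame P st2 st3 -> frame P st1 st3.
Proof.
move=> [f1 b1] [f2 b2]; split; last by rewrite b2.
by move=> t i j Pt; rewrite f2 ?f1.
Qed.

Lemma frameW (P P' : pred nat) st st' :
  frame P st st' -> (forall t, P t -> P' t) -> frame P' st st'.
Proof.
move=> [f b] PP'; split=> // t i j Pt; apply: f.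
by apply: contra Pt => /PP'.
Qed.

Lemma frame_above b b' st st' :
  frame (above b) st st' -> (b' <= b)%N -> frame (above b') st st'.
Proof.
move=> fr le; apply: frameW fr _ => t /orP [H|H]; apply/orP; [by left|right].
exact: leq_trans H.
Qed.

Lemma frame_only b b' st st' :
  frame (only b) st st' -> (b' <= b)%N -> frame (above b') st st'.
Proof.
move=> fr le; apply: frameW fr _ => t /orP [H|/eqP->]; apply/orP; first by left.
by right.
Qed.

Lemma frame_arr (P : pred nat) st st' t m s :
  frame P st st' -> ~~ P t -> arr st' t m s = arr st t m s.
Proof. by move=> [f _] Pt; apply/matrixP => i j; rewrite !mxE f. Qed.

Lemma frame_read_rep (P : pred nat) st st' n r :
  frame P st st' -> ~~ P 0%N -> ~~ P 1%N -> ~~ P 2%N ->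
  read_rep n r st' = read_rep n r st.
Proof.
move=> fr P0 P1 P2; rewrite /read_rep /read_index fr.2 -!/(arr _ _ _ _).
by rewrite !(frame_arr _ _ fr).
Qed.

End Frames.

Inductive fexpr :=
| EConst of bool
| EReg of reg
| EOp of field_op & fexpr & fexpr.

Fixpoint eval (F : fieldType) (st : state F) (e : fexpr) : F :=
  match e with
  | EConst b => b%:R
  | EReg a => freg st a
  | EOp f e1 e2 => eval_op f (eval st e1) (eval st e2)
  end.

Fixpoint avoids (P : pred nat) (e : fexpr) : bool :=
  match e with
  | EConst _ => true
  | EReg a => ~~ P a.1.1
  | EOp _ e1 e2 => avoids P e1 && avoids P e2
  end.

(** Counts the instructions issued by [compile]. A register costs two: there is no copy instruction,
    so it is added to a freshly stored zero. *)
Fixpoint esize (e : fexpr) : nat :=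
  match e with
  | EConst _ => 1
  | EReg _ => 2
  | EOp _ e1 e2 => (esize e1 + esize e2).+1
  end.

Definition esum I (s : seq I) (e : I -> fexpr) : fexpr :=
  foldr (fun i e' => EOp FAdd (e i) e') (EConst false) s.

Section Expressions.
Variable n : nat.

(** Array 3 is used as a stack: the left operand waits in register [(3, d, 0)] while the right one
    is evaluated above it. *)
Fixpoint compile (e : fexpr) (d : nat) : prog n unit :=
  match e with
  | EConst b => FieldConst b (3%N, d, 0%N) (Return n tt)
  | EReg a => FieldConst false (3%N, d, 0%N)
      (FieldOp FAdd (3%N, d, 0%N) a (3%N, d, 0%N) (Return n tt))
  | EOp f e1 e2 => bind (compile e1 d) (fun=> bind (compile e2 d.+1) (fun=>
      FieldOp f (3%N, d, 0%N) (3%N, d, 0%N) (3%N, d.+1, 0%N) (Return n tt)))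
  end.

Definition assign (a : reg) (e : fexpr) : prog n unit :=
  bind (compile e 0) (fun=> FieldConst false (3%N, 1%N, 0%N)
    (FieldOp FAdd a (3%N, 0%N, 0%N) (3%N, 1%N, 0%N) (Return n tt))).

Definition fill (t m s : nat) (e : 'I_m -> 'I_s -> fexpr) : prog n unit :=
  loop (enum {: 'I_m * 'I_s})
    (fun x => assign (t, val x.1, val x.2) (e x.1 x.2)).

Lemma costs_compile e d : costs_exactly (compile e d) (esize e) 0 0 0.
Proof.
elim: e d => [b|a|f e1 IH1 e2 IH2] d //=.
rewrite -addnS -(addn1 (esize e2)).
apply: (costs_exactly_bind (IH1 d) (q' := 0) (b' := 0) (d' := 0)) => _.
by apply: (costs_exactly_bind (IH2 d.+1) (q' := 0) (b' := 0) (d' := 0)).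
Qed.

Lemma costs_assign a e : costs_exactly (assign a e) (esize e + 2) 0 0 0.
Proof.
exact: (costs_exactly_bind (costs_compile e 0) (q' := 0) (b' := 0) (d' := 0)).
Qed.

Lemma costs_fill t m s (e : 'I_m -> 'I_s -> fexpr) w :
  (forall i j, esize (e i j) <= w)%N ->
  costs (fill t e) (m * s * (w + 2)) 0 0 0.
Proof.
move=> H; have := @costs_loop n _ (enum {: 'I_m * 'I_s})
  (fun x => assign (t, val x.1, val x.2) (e x.1 x.2)) (w + 2) 0 0 0.
rewrite -cardE card_prod !card_ord !muln0; apply=> -[i j].
by apply: costs_mono (costs_exactlyW (costs_assign _ _)) _ _ _ => //; rewrite leq_add2r.
Qed.

Lemma esize_esum I (s : seq I) e w :
  (forall i, esize (e i) <= w)%N -> (esize (esum s e) <= size s * w.+1 + 1)%N.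
Proof.
move=> H; elim: s => [|i s IH] //=; rewrite mulSn.
by have := H i; move: IH; rewrite /esum; lia.
Qed.

Lemma avoids_esum (I : eqType) P (s : seq I) e :
  (forall i, avoids P (e i)) -> avoids P (esum s e).
Proof. by move=> H; elim: s => //= i s ->; rewrite H. Qed.

Section Semantics.
Variables (F : fieldType) (A : 'M[F]_n) (mu : nat).
Implicit Types st : state F.

Lemma eval_esum I st (s : seq I) e :
  eval st (esum s e) = \sum_(i <- s) eval st (e i).
Proof. by elim: s => [|i s IH]; rewrite ?big_nil //= big_cons -IH. Qed.

Lemma eval_frame P st st' e :
  frame P st st' -> avoids P e -> eval st' e = eval st e.
Proof.
move=> [f _]; elim: e => [b|[[t i] j]|g e1 IH1 e2 IH2] //=; first exact: f.
by case/andP=> /IH1 -> /IH2 ->.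
Qed.

(** The induction needs the part of array 3 below [d] to survive, since pending left operands are
    kept there. *)
Lemma tri_compile e d st : avoids (pred1 3%N) e ->
  tri A mu (compile e d) st (fun _ st' =>
    [/\ freg st' (3%N, d, 0%N) = eval st e,
        forall a : reg, ~~ ((a.1.1 == 3%N) && (d <= a.1.2)%N) ->
          freg st' a = freg st a
      & breg st' = breg st]).
Proof.
elim: e d st => [b|a|f e1 IH1 e2 IH2] d st /=.
- move=> _ tape /=; rewrite eqxx; split=> // a Ha.
  by case: eqP => // ea; rewrite ea /= leqnn in Ha.
- move=> Ha tape /=; rewrite !eqxx; split=> //.
    by case: eqP => [ea|_]; rewrite ?addr0 //; rewrite ea in Ha.
  move=> a' Ha'; case: eqP => // ea.
  by rewrite ea /= leqnn in Ha'.
case/andP=> av1 av2; apply: tri_bind; apply: tri_mono (IH1 d st av1) _.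
move=> _ st1 [v1 u1 b1]; apply: tri_bind.
apply: tri_mono (IH2 d.+1 st1 av2) _ => _ st2 [v2 u2 b2] tape /=.
rewrite eqxx; split; last by rewrite b2.
  rewrite v2 u2 ?v1 /= ?ltnn //; congr eval_op.
  apply: (@eval_frame (pred1 3%N)) av2; split=> // t i j t3.
  by rewrite u1 //=; apply: contra t3 => /andP [].
move=> a Ha; case: eqP => [ea|_]; first by rewrite ea /= leqnn in Ha.
by rewrite u2 ?u1 //; apply: contra Ha => /andP [-> /ltnW].
Qed.

Lemma tri_assign t i j e st : t != 3%N -> avoids (pred1 3%N) e ->
  tri A mu (assign (t, i, j) e) st (fun _ st' =>
    [/\ freg st' (t, i, j) = eval st e,
        forall t' i' j', t' != 3%N -> (t', i', j') != (t, i, j) ->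
          freg st' (t', i', j') = freg st (t', i', j')
      & breg st' = breg st]).
Proof.
move=> t3 av; apply: tri_bind; apply: tri_mono (tri_compile 0 st av) _.
move=> _ st1 [v u b] tape /=; rewrite !eqxx; split=> //=.
  by rewrite v addr0.
move=> t' i' j' t'3 /negbTE ->; rewrite !xpair_eqE (negbTE t'3) /=.
by rewrite u //= (negbTE t'3).
Qed.

(** The expressions read neither the target array nor the scratch array, so every assignment sees
    the values of the initial state, whatever was assigned before it. *)
Lemma tri_fill t m s (e : 'I_m -> 'I_s -> fexpr) st :
  t != 3%N -> (forall i j, avoids (only t) (e i j)) ->
  tri A mu (fill t e) st (fun _ st' =>
    arr st' t m s = \matrix_(i, j) eval st (e i j) /\ frame (only t) st st').
Proof.
move=> t3 av.
pose P (x : 'I_m * 'I_s) (st' : state F) :=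
  freg st' (t, val x.1, val x.2) = eval st (e x.1 x.2).
apply: tri_mono (_ : tri A mu (fill t e) st (fun _ st' =>
    frame (only t) st st' /\ forall x, x \in enum {: 'I_m * 'I_s} -> P x st')) _.
  apply: tri_loop => // -[i j] st1 _ fr1.
  have av3 : avoids (pred1 3%N) (e i j).
    move: (av i j); elim: (e i j) => [//|a|f e1 IH1 e2 IH2] /=.
      by apply: contra => /eqP ->.
    by case/andP => /IH1 -> /IH2.
  apply: tri_mono (tri_assign _ _ st1 t3 av3) _ => _ st2 [v u b].
  have fr2 : frame (only t) st1 st2.
    split=> // t' i' j' nt; move: nt; rewrite negb_or => /andP [t'3 t't].
    by rewrite u // !xpair_eqE (negbTE t't).
  split=> [||x].
  - exact: frame_trans fr2.
  - by rewrite /P /= v (eval_frame fr1).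
  rewrite /P; have [->|nx] := eqVneq x (i, j) => vx.
    by rewrite v (eval_frame fr1).
  rewrite u // !xpair_eqE eqxx /=; apply: contra nx.
  by case: x {vx} => x1 x2 /= /andP [/eqP/val_inj -> /eqP/val_inj ->].
move=> _ st' [fr H]; split=> //; apply/matrixP => i j; rewrite !mxE.
by apply: (H (i, j)); rewrite mem_enum.
Qed.

End Semantics.
End Expressions.

(** * Products with structured matrices and with the black box *)

Definition multiply n (tr : bool) (src dst s : nat) : prog n unit :=
  loop (enum 'I_s)
    (fun j => BlackBox tr (src, val j) (dst, val j) (Return n tt)).

Lemma costs_multiply n tr src dst s :
  costs (multiply n tr src dst s) 0 s 0 0.
Proof.
have := @costs_loop n _ (enum 'I_s)
  (fun j => BlackBox tr (src, val j) (dst, val j) (Return n tt)) 0 1 0 0.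
rewrite size_enum_ord !muln0 muln1; apply=> j F A mu st tape /=.
by rewrite mul1n addn0.
Qed.

Lemma tri_multiply (F : fieldType) n (A : 'M[F]_n) mu tr src dst s st :
  src != dst ->
  tri A mu (multiply n tr src dst s) st (fun _ st' =>
    arr st' dst n s = (if tr then A^T else A) *m arr st src n s
    /\ frame (only dst) st st').
Proof.
move=> nsd; set A' := if tr then A^T else A.
pose R st' := (forall t i j, t != dst ->
  freg st' (t, i, j) = freg st (t, i, j)) /\ breg st' = breg st.
pose P (j : 'I_s) (st' : state F) := forall i : 'I_n,
  freg st' (dst, val i, val j) = (A' *m arr st src n s) i j.
apply: tri_mono (_ : tri A mu (multiply n tr src dst s) st (fun _ st' =>
    R st' /\ forall j, j \in enum 'I_s -> P j st')) _.
  apply: tri_loop => // j st1 _ [fr1 b1] tape /=; split.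
  - split=> // t i j' tn; rewrite /= xpair_eqE (negbTE tn); exact: fr1.
  - move=> i; rewrite /= eqxx valK !mxE; apply: eq_bigr => l _.
    by rewrite !mxE fr1.
  move=> j' Pj' i /=; rewrite xpair_eqE eqxx /=.
  case: eqP => [/val_inj ej|_]; last exact: Pj'.
  rewrite valK ej !mxE; apply: eq_bigr => l _.
  by rewrite !mxE fr1.
move=> _ st' [[fr b] H]; split.
  by apply/matrixP => i j; rewrite mxE H ?mem_enum.
by split=> // t i j; rewrite negb_or => /andP [_ tn]; apply: fr.
Qed.

(* The i-th entry of a product Z v, with Z a 0/1 matrix, is the sum of the
   entries of v at the positions listed in [rows i]. *)
Definition sparse (F : fieldType) n (Z : 'M[F]_n) (rows : nat -> seq nat) :=
  forall i : 'I_n, all (fun x => (x < n)%N) (rows i) /\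
    forall j : 'I_n, Z i j = (count_mem (val j) (rows i))%:R.

Lemma sparse_mulmx (F : fieldType) n (Z : 'M[F]_n) rows s
    (f : nat -> nat -> F) (i : 'I_n) (j : 'I_s) :
  sparse Z rows ->
  (Z *m \matrix_(i, j) f (val i) (val j)) i j
  = \sum_(x <- rows i) f x (val j).
Proof.
move=> /(_ i) [lt_rows Z_rows]; rewrite mxE.
under eq_bigr => x _ do rewrite Z_rows mxE.
elim: (rows i) lt_rows => [_|x l IH /= /andP [lt_xn /IH {IH}IH]].
  by rewrite big_nil big1 // => x _; rewrite mul0r.
rewrite big_cons -IH (bigD1 (Ordinal lt_xn)) //= [in RHS](bigD1 (Ordinal lt_xn)) //=.
rewrite eqxx natrD mulrDl mul1r -!addrA; congr (_ + (_ + _)).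
apply: eq_bigr => y ny; congr (_%:R * _).
by case: eqP => // ey; case/eqP: ny; apply: val_inj; rewrite /= ey.
Qed.

Lemma sparseD (F : fieldType) n (Z Z' : 'M[F]_n) rows rows' :
  sparse Z rows -> sparse Z' rows' ->
  sparse (Z + Z') (fun i => rows i ++ rows' i).
Proof.
move=> sp sp' i; have [a z] := sp i; have [a' z'] := sp' i.
rewrite all_cat a a'; split=> // j.
by rewrite mxE z z' count_cat natrD.
Qed.

(** The four lists give the positions of the ones in row [i] of $Z_0$, $Z_0^T$, $Z_1$ and $Z_1^T$,
    in this order. *)
Definition shift_down (i : nat) : seq nat := if i is i'.+1 then [:: i'] else [::].
Definition shift_up (n i : nat) : seq nat :=
  if (i.+1 < n)%N then [:: i.+1] else [::].
Definition rotate_down (n i : nat) : seq nat :=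
  if i is i'.+1 then [:: i'] else [:: n.-1].
Definition rotate_up (n i : nat) : seq nat :=
  if (i.+1 < n)%N then [:: i.+1] else [:: 0%N].

Lemma sparse_Z0 (F : fieldType) n : sparse (Zmx n (0 : F)) shift_down.
Proof.
move=> [[|i] lt_in]; split=> [|j] //=.
- by rewrite mxE /=; case: ifP.
- by rewrite andbT ltnW.
by rewrite mxE /= addn0 eqSS; case: eqP.
Qed.

Lemma sparse_Z0T (F : fieldType) n : sparse (Zmx n (0 : F))^T (shift_up n).
Proof.
move=> i; split=> [|j]; rewrite /shift_up; case: ifP => //= lt_in.
- by rewrite lt_in.
- by rewrite !mxE addn0 eq_sym; do !case: eqP.
rewrite !mxE; case: eqP => [ej|_]; first by rewrite -ej ltn_ord in lt_in.
by case: ifP.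
Qed.

Lemma sparse_Z1 (F : fieldType) n : sparse (Zmx n (1 : F)) (rotate_down n).
Proof.
move=> [[|i] lt_in]; split=> [|j] //=; rewrite ?andbT //.
- by rewrite prednK.
- by rewrite mxE /= addn0 eq_sym; case: eqP.
- exact: ltnW.
by rewrite mxE /= addn0 eqSS; case: eqP.
Qed.

Lemma sparse_Z1T (F : fieldType) n : sparse (Zmx n (1 : F))^T (rotate_up n).
Proof.
move=> i; have n0 : (0 < n)%N by apply: leq_trans (ltn_ord i).
split=> [|j]; rewrite /rotate_up; case: ifP => //= lt_in; rewrite ?lt_in ?n0 //.
- rewrite !mxE addn0 eq_sym; case: eqP => // _.
  by case: andP => // -[_ /eqP ei]; rewrite ei prednK // ltnn in lt_in.
rewrite !mxE addn0 eq_sym; case: eqP => [ej|_]; first by rewrite ej ltn_ord in lt_in.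
have -> : i == n.-1 :> nat by have := ltn_ord i; lia.
by rewrite andbT eq_sym; case: eqP.
Qed.

(** * The three operators in the common form $XA - AY$ *)

Definition left_mx (op : displacement) (F : fieldType) n : 'M[F]_n :=
  if op is ToeplitzHankelLike then Zmx n 0 + (Zmx n 0)^T else Zmx n 1.

Definition right_mx (op : displacement) (F : fieldType) n : 'M[F]_n :=
  match op with
  | ToeplitzLike => Zmx n 0
  | HankelLike => (Zmx n 0)^T
  | ToeplitzHankelLike => Zmx n 0 + (Zmx n 0)^T
  end.

Lemma operator_matrixE op (F : fieldType) n (A : 'M[F]_n) :
  operator_matrix op A = left_mx op F n *m A - A *m right_mx op F n.
Proof. by case: op. Qed.

Definition left_rows (op : displacement) n : nat -> seq nat :=
  if op is ToeplitzHankelLike then fun i => shift_down i ++ shift_up n i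
  else rotate_down n.

Definition left_rowsT (op : displacement) n : nat -> seq nat :=
  if op is ToeplitzHankelLike then fun i => shift_up n i ++ shift_down i
  else rotate_up n.

Definition right_rows (op : displacement) n : nat -> seq nat :=
  match op with
  | ToeplitzLike => shift_down
  | HankelLike => shift_up n
  | ToeplitzHankelLike => fun i => shift_down i ++ shift_up n i
  end.

Definition right_rowsT (op : displacement) n : nat -> seq nat :=
  match op with
  | ToeplitzLike => shift_up n
  | HankelLike => shift_down
  | ToeplitzHankelLike => fun i => shift_up n i ++ shift_down i
  end.

Lemma sparse_left op F n : sparse (left_mx op F n) (left_rows op n).
Proof.
case: op; try exact: sparse_Z1.
exact: sparseD (@sparse_Z0 _ _) (@sparse_Z0T _ _).
Qed.

Lemma sparse_leftT op F n : sparse (left_mx op F n)^T (left_rowsT op n).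
Proof.
case: op; try exact: sparse_Z1T.
rewrite /= linearD /= trmxK.
exact: sparseD (@sparse_Z0T _ _) (@sparse_Z0 _ _).
Qed.

Lemma sparse_right op F n : sparse (right_mx op F n) (right_rows op n).
Proof.
case: op; [exact: sparse_Z0|exact: sparse_Z0T|].
exact: sparseD (@sparse_Z0 _ _) (@sparse_Z0T _ _).
Qed.

Lemma sparse_rightT op F n : sparse (right_mx op F n)^T (right_rowsT op n).
Proof.
case: op; rewrite /= ?trmxK; [exact: sparse_Z0T|exact: sparse_Z0|].
rewrite linearD /= trmxK.
exact: sparseD (@sparse_Z0T _ _) (@sparse_Z0 _ _).
Qed.

Definition rows_sum (rows : nat -> seq nat) (t i j : nat) : fexpr :=
  esum (rows i) (fun x => EReg (t, x, j)).

(* B = Z A - A Y and B^T = A^T Z^T - Y^T A^T. *)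
Definition apply_operator (op : displacement) n (tr : bool) (src t s : nat) :
    prog n unit :=
  let inner := if tr then left_rowsT op n else right_rows op n in
  let outer := if tr then right_rowsT op n else left_rows op n in
  bind (multiply n tr src t s) (fun=>
  bind (@fill n t.+1 n s (fun i j => rows_sum inner src i j)) (fun=>
  bind (multiply n tr t.+1 t.+2 s) (fun=>
  @fill n t.+3 n s (fun i j =>
    let x := rows_sum outer t i j in
    let y := EReg (t.+2, val i, val j) in
    if tr then EOp FSub y x else EOp FSub x y)))).

(** Two ones per row at most: besides the black-box products, applying the operator costs O(n)
    operations per column. *)
Lemma size_rows op n i :
  [/\ size (left_rows op n i) <= 2, size (left_rowsT op n i) <= 2,
      size (right_rows op n i) <= 2 & size (right_rowsT op n i) <= 2]%N.
Proof.
rewrite /left_rows /left_rowsT /right_rows /right_rowsT /shift_down /shift_up.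
by rewrite /rotate_down /rotate_up; case: op; case: i => [|i];
  case: ifP.
Qed.

Lemma costs_apply_operator op n tr src t s :
  costs (apply_operator op n tr src t s) (n * s * 21) (2 * s) 0 0.
Proof.
have sz rows i j t' : (size (rows i) <= 2)%N ->
    (esize (rows_sum rows t' i j) <= 7)%N.
  move=> le2; apply: leq_trans (esize_esum (w := 2) _ _) _ => //.
  by rewrite (leq_add2r 1 _ 6) (leq_mul2r 3 _ 2) le2.
(* Two registers sum to an expression of size at most 7, and subtracting from or by a register gives
   10; each assignment adds 2. *)
apply: costs_mono (_ : costs _ (0 + (n * s * (7 + 2) + (0 + n * s * (10 + 2))))
  (s + (0 + (s + 0))) (0 + (0 + (0 + 0))) (0 + (0 + (0 + 0)))) _ _ _; try lia.
apply: costs_bind; first exact: costs_multiply.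
move=> _; apply: costs_bind.
  by apply: costs_fill => i j; apply: sz; case: tr; have [] := size_rows op n i.
move=> _; apply: costs_bind; first exact: costs_multiply.
move=> _; apply: costs_fill => i j.
have := sz (if tr then right_rowsT op n else left_rows op n) i j t.
by have [sl slT sr srT] := size_rows op n i; case: tr => /(_ _)/=; lia.
Qed.

(** Array [t] receives the black-box product with U, [t.+1] the inner structured product, [t.+2] the
    black-box product of the latter, and [t.+3] the difference, where the outer structured product
    is formed on the fly. *)
Lemma tri_apply_operator (F : fieldType) op n (A : 'M[F]_n) mu tr src t s st :
  src != 3%N -> (src < t)%N -> (3 < t)%N ->
  tri A mu (apply_operator op n tr src t s) st (fun _ st' =>
    let B := operator_matrix op A in
    arr st' t.+3 n s = (if tr then B^T else B) *m arr st src n s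
    /\ frame (above t) st st').
Proof.
move=> src3 lt_src lt_t; rewrite /apply_operator.
set A' := if tr then A^T else A.
set inner := if tr then left_rowsT op n else right_rows op n.
set outer := if tr then right_rowsT op n else left_rows op n.
(* The inner factor acts before the black box and the outer one after it; transposition exchanges
   the left and right factors and reverses the subtraction. *)
pose Zi := if tr then (left_mx op F n)^T else right_mx op F n.
pose Zo := if tr then (right_mx op F n)^T else left_mx op F n.
have sp_i : sparse Zi inner.
  by rewrite /Zi /inner; case: (tr); [exact: sparse_leftT|exact: sparse_right].
have sp_o : sparse Zo outer.
  by rewrite /Zo /outer; case: (tr); [exact: sparse_rightT|exact: sparse_left].
apply: tri_bind; apply: tri_mono (tri_multiply _ _ _ _ _ _) _; first by lia.
move=> _ st1 [e1 f1].
apply: tri_bind; apply: tri_mono (tri_fill _ _ _ _ _) _; first by lia.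
  by move=> i j; apply: avoids_esum => x; rewrite /= /only; lia.
move=> _ st2 [e2 f2].
apply: tri_bind; apply: tri_mono (tri_multiply _ _ _ _ _ _) _; first by lia.
move=> _ st3 [e3 f3].
apply: tri_mono (tri_fill _ _ _ _ _) _; first by lia.
  move=> i j; have av : avoids (only t.+3) (rows_sum outer t i j).
    by apply: avoids_esum => x; rewrite /= /only; lia.
  by case: (tr) => /=; rewrite av /only /=; lia.
move=> _ st4 [e4 f4]; split; last first.
  apply: frame_trans (frame_only f1 (leqnn t)) _.
  apply: frame_trans (frame_only f2 (leqnSn t)) _.
  apply: frame_trans (frame_only f3 _) (frame_only f4 _); lia.
set U := arr st src n s in e1 *.
have eU : arr st1 src n s = U by apply: (frame_arr _ _ f1); rewrite /only; lia.
have e2' : arr st2 t.+1 n s = Zi *m U.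
  rewrite e2; apply/matrixP => i j; rewrite mxE eval_esum -eU.
  by rewrite -(sparse_mulmx (fun x y => freg st1 (src, x, y)) i j sp_i).
have e3' : arr st3 t.+2 n s = A' *m (Zi *m U) by rewrite e3 e2'.
have e1' : arr st3 t n s = A' *m U.
  rewrite -e1 -(frame_arr (t := t) _ _ f2); last by rewrite /only; lia.
  by apply: (frame_arr _ _ f3); rewrite /only; lia.
have -> : (if tr then (operator_matrix op A)^T else operator_matrix op A) *m U
    = if tr then A' *m (Zi *m U) - Zo *m (A' *m U)
      else Zo *m (A' *m U) - A' *m (Zi *m U).
  rewrite operator_matrixE /A' /Zi /Zo; case: (tr).
    by rewrite linearB /= !trmx_mul mulmxBl !mulmxA.
  by rewrite mulmxBl !mulmxA.
have sum_o (i : 'I_n) (j : 'I_s) :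
    eval st3 (rows_sum outer t i j) = (Zo *m (A' *m U)) i j.
  rewrite eval_esum -e1'.
  by rewrite -(sparse_mulmx (fun x y => freg st3 (t, x, y)) i j sp_o).
have reg3 (i : 'I_n) (j : 'I_s) :
    freg st3 (t.+2, val i, val j) = (A' *m (Zi *m U)) i j.
  by rewrite -e3' mxE.
have subE (M N : 'M[F]_(n, s)) i j : (M - N) i j = M i j - N i j.
  by rewrite !mxE.
rewrite e4; apply/matrixP => i j; rewrite mxE.
by case: (tr); rewrite subE -sum_o -reg3.
Qed.

(** * Column reduction *)

Section Reduction.
Variables (F : fieldType) (n s : nat).
Implicit Types (M : 'M[F]_(n, s)) (ps : seq ('I_n * 'I_s)).

(** A Gauss-Jordan step on columns. It also acts on the columns already treated, so that earlier
    pivot columns get a zero in the new pivot row. *)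
Definition pivot_mx M i j : 'M[F]_(n, s) :=
  \matrix_(i', c) if c == j then M i' j / M i j
                  else M i' c - M i c * (M i' j / M i j).

(* The columns of M outside [cols] have been treated: those at the pivots [ps]
   carry an identity matrix in the pivot rows, and the others are zero. *)
Definition reduced M (cols : seq 'I_s) ps :=
  [/\ forall p, p \in ps -> p.2 \notin cols,
      uniq (unzip2 ps),
      forall p c, p \in ps -> M p.1 c = (c == p.2)%:R
    & forall i c, c \notin cols -> c \notin unzip2 ps -> M i c = 0].

Lemma reduced_start M : reduced M (enum 'I_s) [::].
Proof. by split=> // i c; rewrite mem_enum. Qed.

Lemma reduced_skip M j cols ps :
  reduced M (j :: cols) ps -> (forall i, M i j = 0) -> reduced M cols ps.
Proof.
case=> [nc uq d z] zj; split=> // [p /nc|i c ncols nps].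
  by rewrite inE negb_or => /andP [].
have [->|ncj] := eqVneq c j; first exact: zj.
by rewrite z // inE negb_or ncj.
Qed.

(** Column [j] vanishes in the earlier pivot rows, so these rows keep their unit pattern when
    multiples of it are subtracted; a zero column has a zero in row [i], so nothing is subtracted
    from it. *)
Lemma reduced_pivot M i j cols ps :
  j \notin cols -> M i j != 0 -> reduced M (j :: cols) ps ->
  reduced (pivot_mx M i j) cols (rcons ps (i, j)).
Proof.
move=> ncj nz [nc uq d z]; split=> [p||p c|i' c ncols].
- rewrite mem_rcons inE => /orP [/eqP -> //|/nc].
  by rewrite inE negb_or => /andP [].
- rewrite /unzip2 map_rcons rcons_uniq uq andbT.
  by apply/mapP => -[p /nc /[swap] /= <-]; rewrite mem_head.
- rewrite mem_rcons inE mxE => /orP [/eqP -> /=|pps].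
    by case: eqP => _; rewrite divff // mulr1 subrr.
  have npj : j != p.2.
    by apply: contraNneq (nc _ pps) => <-; rewrite mem_head.
  rewrite !(d p _ pps) (negbTE npj) mul0r mulr0 subr0.
  by case: eqP => // ->; rewrite (negbTE npj).
rewrite /unzip2 map_rcons mem_rcons inE negb_or /= => /andP [cj cps].
rewrite mxE (negbTE cj) !(z _ c) ?mul0r ?subr0 //;
  by rewrite inE negb_or cj.
Qed.

(** The step is invertible: the old column [j] is the pivot times the new one, and adding multiples
    of the new one back recovers the other columns. *)
Lemma pivot_mx_span M i j : M i j != 0 -> ((pivot_mx M i j)^T :=: M^T)%MS.
Proof.
move=> nz; have in_row c : (row c M^T <= M^T)%MS by exact: row_sub.
have in_row' c : (row c (pivot_mx M i j)^T <= (pivot_mx M i j)^T)%MS.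
  exact: row_sub.
apply/eqmxP/andP; split; apply/row_subP => c.
  have [->|ncj] := eqVneq c j.
    have -> : row j (pivot_mx M i j)^T = (M i j)^-1 *: row j M^T.
      by apply/rowP => x; rewrite !mxE eqxx mulrC.
    exact: scalemx_sub.
  have -> : row c (pivot_mx M i j)^T
      = row c M^T - (M i c / M i j) *: row j M^T.
    by apply/rowP => x; rewrite !mxE (negbTE ncj); ring.
  by rewrite addmx_sub // eqmx_opp scalemx_sub.
have [->|ncj] := eqVneq c j.
  have -> : row j M^T = M i j *: row j (pivot_mx M i j)^T.
    by apply/rowP => x; rewrite !mxE eqxx; field.
  exact: scalemx_sub.
have -> : row c M^T
    = row c (pivot_mx M i j)^T + M i c *: row j (pivot_mx M i j)^T.
  by apply/rowP => x; rewrite !mxE (negbTE ncj) eqxx; ring.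
by rewrite addmx_sub // scalemx_sub.
Qed.

End Reduction.

(** The columns of [E] form a basis of the column space of [M] for which the rows selected by [f]
    are coordinates. Column spaces appear as row spaces of transposes, in keeping with [%MS]. *)
Definition column_basis (F : fieldType) n s rho (M : 'M[F]_(n, s))
    (f : 'I_rho -> 'I_n) (E : 'M[F]_(n, rho)) :=
  rowsub f E = 1%:M /\ (E^T :=: M^T)%MS.

(** Once no column is left to treat, the columns without a pivot are zero, so the pivot columns
    span; being distinct, they carry the identity in the pivot rows. *)
Lemma reduced_basis (F : fieldType) n s rho (M : 'M[F]_(n, s))
    (ps : rho.-tuple ('I_n * 'I_s)) :
  reduced M [::] ps ->
  column_basis M (fun l => (tnth ps l).1)
    (\matrix_(i, l) M i (tnth ps l).2).
Proof.
case=> [_ uq d z]; split.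
  apply/matrixP => l l'; rewrite !mxE d ?mem_tnth // eq_sym.
  rewrite -!(tnth_map snd) (inj_eq (f := tnth _)) //.
  by apply/tuple_uniqP.
apply/eqmxP/andP; split; apply/row_subP => c.
  have -> : row c (\matrix_(i, l) M i (tnth ps l).2)^T = row (tnth ps c).2 M^T.
    by apply/rowP => x; rewrite !mxE.
  exact: row_sub.
have [/mapP [p /tnthP [l ->] ->]|nps] := boolP (c \in unzip2 ps).
  have -> : row (tnth ps l).2 M^T = row l (\matrix_(i, l) M i (tnth ps l).2)^T.
    by apply/rowP => x; rewrite !mxE.
  exact: row_sub.
have -> : row c M^T = 0 by apply/rowP => x; rewrite !mxE z.
exact: sub0mx.
Qed.

Section ColumnBasis.
Variables (F : fieldType) (n s rho : nat) (M : 'M[F]_(n, s)).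
Variables (f : 'I_rho -> 'I_n) (E : 'M[F]_(n, rho)).
Hypothesis basis : column_basis M f E.

(** [E] contains an identity block of size [rho], hence has full column rank. *)
Lemma column_basis_rank : \rank M = rho.
Proof.
case: basis => E1 EM; rewrite -mxrank_tr -EM mxrank_tr.
apply/eqP; rewrite eqn_leq rank_leq_col /=.
rewrite -{1}(mxrank1 F rho) -E1 rowsubE; exact: mxrankM_maxr.
Qed.

(** Write B as E X; restricting to the pivot rows identifies X as the pivot rows of B. *)
Lemma column_basis_interp m (B : 'M[F]_(n, m)) :
  (B^T <= M^T)%MS -> B = E *m rowsub f B.
Proof.
case: basis => E1 EM; rewrite -EM => /submxP [X eX].
have {eX}eB : B = E *m X^T by rewrite -[B]trmxK eX trmx_mul trmxK.
by rewrite {2}eB -mul_rowsub_mx E1 mul1mx.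
Qed.

Lemma column_basis_inj : injective f.
Proof.
case: basis => E1 _ l l' ef; have := congr1 (fun X : 'M_rho => X l l) E1.
have := congr1 (fun X : 'M_rho => X l' l) E1.
rewrite !mxE ef eqxx => ->; case: eqP => // _ /eqP.
by rewrite eq_sym oner_eq0.
Qed.

End ColumnBasis.

(** * Gauss-Jordan elimination as a program *)

Section Elimination.
Variables n s : nat.

Fixpoint find_pivot (t : nat) (j : 'I_s) (rows : seq 'I_n) :
    prog n (option 'I_n) :=
  if rows is i :: rows' then
    FieldTest (t, val i, val j) (find_pivot t j rows') (Return n (Some i))
  else Return n None.

Definition pivot_step (t : nat) (i : 'I_n) (j : 'I_s) : prog n unit :=
  fill n t.+1 (fun (i' : 'I_n) (c : 'I_s) =>
    let x := EOp FDiv (EReg (t, val i', val j)) (EReg (t, val i, val j)) in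
    if c == j then x
    else EOp FSub (EReg (t, val i', val c))
           (EOp FMul (EReg (t, val i, val c)) x)).

(* Each pivot step writes its result to a new array; the number of the last
   array is returned along with the pivots. *)
Fixpoint eliminate (t : nat) (cols : seq 'I_s) (ps : seq ('I_n * 'I_s)) :
    prog n (nat * seq ('I_n * 'I_s)) :=
  if cols is j :: cols' then
    bind (find_pivot t j (enum 'I_n)) (fun oi =>
      if oi is Some i then
        bind (pivot_step t i j)
          (fun=> eliminate t.+1 cols' (rcons ps (i, j)))
      else eliminate t cols' ps)
  else Return n (t, ps).

Lemma costs_find_pivot t j rows : costs (find_pivot t j rows) (size rows) 0 0 0.
Proof.
elim: rows => [|i rows IH] F A mu st tape //=.
case: ifP => _ //=; have [a b ->] := IH F A mu st tape.
by split.
Qed.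

Lemma costs_eliminate t cols ps :
  costs (eliminate t cols ps) (size cols * (n + n * s * 13)) 0 0 0.
Proof.
elim: cols t ps => [|j cols IH] t ps; first by [].
rewrite /= mulSn -addnA.
apply: (costs_bind (q := 0) (q' := 0) (b := 0) (b' := 0) (d := 0) (d' := 0)) => [|[i|]].
- by apply: (costs_mono (costs_find_pivot t j _)); rewrite ?size_enum_ord.
- apply: (costs_bind (q := 0) (q' := 0) (b := 0) (b' := 0) (d := 0) (d' := 0)) => //.
  (* A quotient of registers has size 5, its product with a register 8, and the difference 11. *)
  by apply: (costs_fill _ (w := 11)) => i' c; case: (c == j).
by apply: (costs_mono (IH _ _)) => //; apply: leq_addl.
Qed.

Variables (F : fieldType) (A : 'M[F]_n) (mu : nat).

Lemma tri_find_pivot t j rows st :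
  tri A mu (find_pivot t j rows) st (fun oi st' => st' = st /\
    if oi is Some i then freg st (t, val i, val j) != 0
    else forall i, i \in rows -> freg st (t, val i, val j) = 0).
Proof.
elim: rows => [|i rows IH] tape //=.
case: eqP => [z|nz] /=; last by split=> //; apply/eqP.
have [-> H] := IH tape; split=> //; case: (leaf _) H => // H i'.
by rewrite inE => /orP [/eqP -> //|/H].
Qed.

(** The frame leaves array [t] itself intact, so the unreduced matrix can still be read afterwards;
    the block C of the certificate is taken from it. *)
Lemma tri_eliminate t cols ps st : (3 < t)%N -> uniq cols ->
  reduced (arr st t n s) cols ps ->
  tri A mu (eliminate t cols ps) st (fun res st' =>
    let M := arr st' res.1 n s in
    [/\ (t <= res.1)%N, frame (above t.+1) st st', reduced M [::] res.2
      & (M^T :=: (arr st t n s)^T)%MS]).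
Proof.
elim: cols t ps st => [|j cols IH] t ps st lt3 /=; first by move=> _ red tape.
case/andP=> njc uq red; apply: tri_bind.
apply: tri_mono (tri_find_pivot _ _ _ _) _ => -[i|] _ [-> H]; last first.
  apply: IH => //; apply: reduced_skip red _ => i.
  by rewrite mxE H // mem_enum.
apply: tri_bind; apply: tri_mono (tri_fill _ _ _ _ _) _; first by lia.
  by move=> i' c; case: (c == j) => /=; rewrite /only; lia.
move=> _ st1 [e1 f1].
have {}e1 : arr st1 t.+1 n s = pivot_mx (arr st t n s) i j.
  by rewrite e1; apply/matrixP => i' c; rewrite !mxE; case: ifP.
have nz : arr st t n s i j != 0 by rewrite mxE.
apply: tri_mono (IH t.+1 _ st1 _ uq _) _; first by lia.
  by rewrite e1; apply: reduced_pivot.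
move=> [t' ps'] st2 /= [le fr red' sp]; split=> //; first exact: ltnW.
  apply: frame_trans (frame_only f1 (leqnn _)) _.
  exact: frame_above fr _.
by apply: eqmx_trans sp _; rewrite e1; apply: pivot_mx_span.
Qed.

End Elimination.

(** * Permutations and certificates *)

(** The indices are known from the control flow, so each bit is stored by a constant bit
    operation. *)
Definition write_bits n (t : nat) (v : 'I_n -> nat) : prog n unit :=
  loop (enum {: 'I_n * 'I_(up_log 2 n)}) (fun x =>
    let a := (t, val x.1, val x.2) in
    BitOp (fun _ _ => odd (v x.1 %/ 2 ^ x.2)) a a a (Return n tt)).

(** Bit tests turn the stored indices into control flow, after which they can serve as addresses. *)
Definition read_bits n (t : nat) : prog n (seq nat) :=
  mapM (fun i : 'I_n =>
    bind (mapM (fun b : 'I_(up_log 2 n) =>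
            BitTest (t, val i, val b) (Return n false) (Return n true))
            (enum 'I_(up_log 2 n)))
      (fun bs => Return n
        (\sum_(b < up_log 2 n) nth false bs b * 2 ^ b)%N))
    (enum 'I_n).

Lemma costs_write_bits n t (v : 'I_n -> nat) :
  costs (write_bits t v) 0 0 (n * up_log 2 n) 0.
Proof.
have := @costs_loop n _ (enum {: 'I_n * 'I_(up_log 2 n)}) (fun x =>
    let a := (t, val x.1, val x.2) in
    BitOp (fun _ _ => odd (v x.1 %/ 2 ^ x.2)) a a a (Return n tt)) 0 0 1 0.
by rewrite -cardE card_prod !card_ord !muln0 muln1; apply=> x F A mu st tape.
Qed.

Lemma costs_read_bits n t : costs (read_bits n t) 0 0 (n * up_log 2 n) 0.
Proof.
rewrite /read_bits; set f := fun i : 'I_n => _.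
have := @costs_mapM n _ _ f (enum 'I_n) 0 0 (up_log 2 n) 0.
rewrite size_enum_ord !muln0; apply=> i; rewrite {}/f.
rewrite -[X in costs _ _ _ X]addn0.
apply: (costs_bind (a := 0) (a' := 0) (q := 0) (q' := 0) (d := 0) (d' := 0)) => //.
set g := fun b : 'I__ => _.
have := @costs_mapM n _ _ g (enum 'I_(up_log 2 n)) 0 0 1 0.
rewrite size_enum_ord !muln0 muln1; apply=> b F A mu st tape.
by rewrite /g /=; case: ifP.
Qed.

Lemma sum_bits m v : (v < 2 ^ m)%N ->
  (\sum_(b < m) odd (v %/ 2 ^ b) * 2 ^ b)%N = v.
Proof.
elim: m v => [|m IH] v; first by rewrite expn0 ltnS leqn0 big_ord0 => /eqP ->.
move=> lt_v; rewrite big_ord_recl expn0 divn1 muln1.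
under eq_bigr => b _ do
  rewrite lift0 !expnS divnMA divn2 mulnCA.
rewrite -big_distrr /= IH; first by rewrite mul2n odd_double_half.
by rewrite -divn2 ltn_divLR // -expnSr.
Qed.

Section Bits.
Variables (F : fieldType) (n : nat) (A : 'M[F]_n) (mu : nat).
Implicit Types st : state F.

Lemma tri_write_bits t (v : 'I_n -> nat) st :
  (forall i, v i < n)%N ->
  tri A mu (write_bits t v) st (fun _ st' =>
    [/\ freg st' = freg st,
        forall t' i b, t' != t -> breg st' (t', i, b) = breg st (t', i, b)
      & forall i : 'I_n, read_index n st' t i = v i]).
Proof.
move=> lt_v.
pose R st' := freg st' = freg st /\
  forall t' i b, t' != t -> breg st' (t', i, b) = breg st (t', i, b).
pose P (x : 'I_n * 'I_(up_log 2 n)) st' :=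
  breg st' (t, val x.1, val x.2) = odd (v x.1 %/ 2 ^ x.2).
apply: tri_mono (_ : tri A mu (write_bits t v) st (fun _ st' =>
    R st' /\ forall x, x \in enum {: 'I_n * 'I_(up_log 2 n)} -> P x st')) _.
  apply: tri_loop => // -[i b] st1 _ [f1 b1] tape /=; split.
  - split=> //= t' i' b' nt; rewrite !xpair_eqE (negbTE nt); exact: b1.
  - by rewrite /P /= eqxx.
  move=> [i' b']; rewrite /P /= !xpair_eqE eqxx /=.
  by case: andP => // -[/eqP/val_inj -> /eqP/val_inj ->].
move=> _ st' [[f b] H]; split=> // i.
rewrite /read_index -[RHS](@sum_bits (up_log 2 n)); last first.
  exact: leq_trans (lt_v i) (up_logP _ _).
by apply: eq_bigr => x _; rewrite (H (i, x)) ?mem_enum.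
Qed.

Lemma reads_read_bits t st :
  reads A mu (read_bits n t) st
    [seq read_index n st t (val i) | i <- enum 'I_n].
Proof.
apply: (reads_mapM (g := fun i : 'I_n => read_index n st t i)) => i.
apply: (reads_bind (x :=
    [seq breg st (t, val i, val b) | b <- enum 'I_(up_log 2 n)])).
  by apply: (reads_mapM (g := fun b : 'I__ => breg st (t, val i, val b))) => b tape;
    rewrite /=; case: ifP.
move=> tape /=; split=> //; apply: eq_bigr => b _.
by rewrite (nth_map b) ?size_enum_ord // nth_ord_enum.
Qed.

End Bits.

(** Stated on integer vectors, so that programs, which do not mention the field, can branch on
    it. *)
Definition is_perm_fun n (p : 'I_n -> nat) : bool :=
  [exists s : 'S_n, [forall i, p i == val (s i)]].

Lemma index_mx_perm (F : fieldType) n (p : 'I_n -> nat) (s : 'S_n) :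
  (forall i, p i = s i) -> index_mx F p = perm_mx s.
Proof.
by move=> ps; apply/matrixP => i j; rewrite !mxE ps.
Qed.

Lemma is_perm_index_mx (F : fieldType) n (p : 'I_n -> nat) :
  is_perm_mx (index_mx F p) = is_perm_fun p.
Proof.
apply/existsP/existsP => -[s]; last first.
  by move/forallP=> ps; exists s; apply/eqP/index_mx_perm => i; apply/eqP/ps.
move/eqP/matrixP => ps; exists s; apply/forallP => i.
by have := ps i (s i); rewrite !mxE eqxx; case: eqP => // _ /eqP;
  rewrite eq_sym oner_eq0.
Qed.

(** * Completing an injective family of pivots to a permutation *)

Section Complete.
Variables (n r : nat) (f : 'I_r -> 'I_n).

(** Pivots come first, in the order of [f], then the other indices. For injective [f], [pos] gives
    the place of an index in this list and [elt] is its inverse. *)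
Definition completion : seq 'I_n :=
  codom f ++ [seq i <- enum 'I_n | i \notin codom f].

Definition pos (i : 'I_n) : nat := index i completion.
Definition elt (x : nat) : nat := nth 0%N [seq val i | i <- completion] x.

Hypothesis f_inj : injective f.

Lemma perm_completion : perm_eq completion (enum 'I_n).
Proof.
apply: uniq_perm; rewrite ?enum_uniq //.
  rewrite cat_uniq filter_uniq ?enum_uniq // andbT; apply/andP; split.
    by apply/injectiveP.
  by apply/hasPn => i; rewrite mem_filter => /andP [].
move=> i; rewrite mem_cat mem_filter mem_enum andbT.
by case: (i \in codom f).
Qed.

Lemma size_completion : size completion = n.
Proof. by rewrite (perm_size perm_completion) size_enum_ord. Qed.

Lemma mem_completion i : i \in completion.
Proof. by rewrite (perm_mem perm_completion) mem_enum. Qed.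

Lemma pos_lt i : (pos i < n)%N.
Proof. by rewrite -[X in (_ < X)%N]size_completion index_mem mem_completion. Qed.

Lemma elt_pos i : elt (pos i) = i.
Proof.
by rewrite /elt (nth_map i) ?nth_index ?mem_completion // size_completion pos_lt.
Qed.

Lemma elt_lt (a : 'I_n) : (elt a < n)%N.
Proof. by rewrite /elt (nth_map a) ?ltn_ord // size_completion. Qed.

Lemma pos_image l : pos (f l) = l.
Proof.
rewrite /pos index_cat codom_f /codom /image_mem index_map //.
exact: index_enum_ord.
Qed.

Lemma elt_image (l : 'I_r) : elt l = f l.
Proof. by rewrite -(elt_pos (f l)) pos_image. Qed.

Lemma completion_perm : exists s : 'S_n,
  (forall i, pos i = s i) /\ (forall a : 'I_n, elt a = (s^-1)%g a).
Proof.
have inj : injective (fun i => Ordinal (pos_lt i)).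
  by move=> i j [e]; apply: val_inj; rewrite /= -(elt_pos i) -(elt_pos j) e.
exists (perm inj); split=> [i|a]; first by rewrite permE.
rewrite -{1}[a](permKV (perm inj)) permE /=; exact: elt_pos.
Qed.

End Complete.

Lemma castmx_col_mx (F : fieldType) n r (le_rn : (r <= n)%N)
    (h : nat -> 'I_r -> F) :
  castmx (subnKC le_rn, erefl r)
    (col_mx 1%:M (\matrix_(a < n - r, l < r) h a l))
  = \matrix_(x < n, l < r)
      if (x < r)%N then (x == l :> nat)%:R else h (x - r)%N l.
Proof.
apply/matrixP => x l; rewrite castmxE mxE [RHS]mxE cast_ord_id.
case: splitP => a /= ->; first by rewrite ltn_ord mxE.
by rewrite ltnNge leq_addr /= mxE addKn.
Qed.

Lemma castmx_row_mx (F : fieldType) n r (le_rn : (r <= n)%N)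
    (h : nat -> 'I_r -> F) :
  castmx (erefl r, subnKC le_rn)
    (row_mx 1%:M (\matrix_(l < r, a < n - r) h a l))
  = (\matrix_(x < n, l < r)
      if (x < r)%N then (x == l :> nat)%:R else h (x - r)%N l)^T.
Proof.
rewrite -castmx_col_mx trmx_cast tr_col_mx trmx1 /=.
by congr (castmx _ (row_mx _ _)); apply/matrixP => i j; rewrite !mxE.
Qed.

(** Listing the pivot rows first turns E into the block column of the identity and L, because the
    pivot rows of E form an identity; the permutation given by [pos f] restores the original
    order. *)
Lemma perm_basis (F : fieldType) n r (f : 'I_r -> 'I_n) (h : nat -> 'I_r -> F) :
  injective f -> rowsub f (\matrix_(i < n, l < r) h i l) = 1%:M ->
  index_mx F (pos f) *m (\matrix_(x < n, l < r)
      if (x < r)%N then (x == l :> nat)%:R else h (elt f (r + (x - r))) l)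
  = \matrix_(i < n, l < r) h i l.
Proof.
move=> inj E1; have [s [ps _]] := completion_perm inj.
rewrite (index_mx_perm F ps) -row_permE; apply/matrixP => i l; rewrite !mxE.
have es : elt f (s i) = i by rewrite -ps elt_pos.
case: ltnP => [lt_r|/subnKC ->]; last by rewrite es.
rewrite -[X in h X _]es -[val (s i)]/(val (Ordinal lt_r)) elt_image //.
have := congr1 (fun X : 'M[F]_r => X (Ordinal lt_r) l) E1.
by rewrite !mxE => ->.
Qed.

(** P is given by [pos] but Q by [elt]: Q stands on the right of the row factor, so the statement
    about G is transposed and the permutation inverted. *)
Lemma rep_value_bases (F : fieldType) n r (le_rn : (r <= n)%N)
    (c : representation F n r) (f g : 'I_r -> 'I_n) (hE hG : nat -> 'I_r -> F) :
  injective f -> injective g ->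
  rowsub f (\matrix_(i < n, l < r) hE i l) = 1%:M ->
  rowsub g (\matrix_(i < n, l < r) hG i l) = 1%:M ->
  (forall i, rep_p c i = pos f i) -> (forall i : 'I_n, rep_q c i = elt g i) ->
  rep_L c = \matrix_(a, l) hE (elt f (r + a)) l ->
  rep_R c = \matrix_(l, a) hG (elt g (r + a)) l ->
  rep_value le_rn c = (\matrix_(i < n, l < r) hE i l) *m rep_C c
                      *m (\matrix_(i < n, l < r) hG i l)^T.
Proof.
move=> injf injg E1 G1 ep eq eL eR; rewrite /rep_value eL eR.
rewrite (castmx_col_mx le_rn (fun a l => hE (elt f (r + a)) l)).
rewrite (castmx_row_mx le_rn (fun a l => hG (elt g (r + a)) l)).
have -> : index_mx F (rep_p c) = index_mx F (pos f).
  by apply/matrixP => i j; rewrite !mxE ep.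
have [s [ps es]] := completion_perm injg.
have -> : index_mx F (rep_q c) = (index_mx F (pos g))^T.
  rewrite (index_mx_perm F ps) tr_perm_mx; apply: index_mx_perm => i.
  by rewrite eq es.
by rewrite perm_basis // -!mulmxA -trmx_mul perm_basis // !mulmxA.
Qed.

(** * The check *)

Section Draws.
Variables (F : fieldType) (n : nat) (A : 'M[F]_n) (mu : nat).

(** Filling column by column makes each block of [m] consecutive draws one column, which is the unit
    of the rank count. *)
Definition draw_matrix (t m s : nat) : prog n unit :=
  loop (iota 0 (s * m))
    (fun x => FieldDraw (t, (x %% m)%N, (x %/ m)%N) (Return n tt)).

Lemma costs_draw_matrix t m s : costs (draw_matrix t m s) 0 0 0 (s * m).
Proof.
have := @costs_loop n _ (iota 0 (s * m))
  (fun x => FieldDraw (t, (x %% m)%N, (x %/ m)%N) (Return n tt)) 0 0 0 1.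
by rewrite size_iota !muln0 muln1; apply.
Qed.

Lemma run_draw_matrix t m s st tape :
  let st' := final (run A mu (draw_matrix t m s) st tape) in
  arr st' t m s = \matrix_(i, j) tape`_(j * m + i) /\ frame (pred1 t) st st'.
Proof.
(* Generalised to draws numbered from [a] on, with the entries of smaller number left alone. *)
have key a b st0 tape0 :
    let st' := final (run A mu (loop (iota a b)
      (fun x => FieldDraw (t, (x %% m)%N, (x %/ m)%N) (Return n tt))) st0 tape0) in
    [/\ forall i j, (i < m)%N -> (j * m + i < a)%N ->
          freg st' (t, i, j) = freg st0 (t, i, j),
        forall i j, (i < m)%N -> (a <= j * m + i < a + b)%N ->
          freg st' (t, i, j) = tape0`_(j * m + i - a)
      & frame (pred1 t) st0 st'].
  elim: b a st0 tape0 => [|b IH] a st0 tape0 /=.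
    by split=> // i j _; rewrite addn0 ltnNge => /andP [->].
  rewrite /charge /=; set st1 := set_freg _ _ _.
  have [old new fr] := IH a.+1 st1 (behead tape0); split.
  - move=> i j lt_i lt_a; rewrite old //; last exact: ltnW.
    rewrite /st1 /= !xpair_eqE eqxx /=; case: andP => // -[/eqP ei /eqP ej].
    by move: lt_a; rewrite ei ej -divn_eq ltnn.
  - move=> i j lt_i /andP [le_a lt_b].
    have [ea|na] := eqVneq (j * m + i)%N a; last first.
      rewrite new //; last by lia.
      by rewrite nth_behead; congr (_`_ _); lia.
    rewrite old //; last by rewrite ea.
    rewrite ea subnn nth0 /st1 /= -ea modnMDl modn_small //.
    by rewrite divnMDl ?divn_small ?addn0 ?eqxx //; apply: leq_trans lt_i.
  apply: frame_trans fr; split=> // t' i j /= /negbTE nt.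
  by rewrite /st1 /= !xpair_eqE nt.
have [_ new fr] := key 0%N (s * m)%N st tape; split=> //.
apply/matrixP => i j; rewrite mxE [RHS]mxE new ?ltn_ord ?subn0 //=.
rewrite add0n; apply: leq_trans (_ : (j * m + m <= _)%N).
  by rewrite ltn_add2l.
by rewrite -mulSnr leq_mul2r ltn_ord orbT.
Qed.

End Draws.

Section Programs.
Variables (op : displacement) (n : nat).

Definition pad (a q b : nat) : prog n unit :=
  let junk : reg := (3, 0, 0)%N in
  bind (loop (nseq a tt) (fun=> FieldConst false junk (Return n tt))) (fun=>
  bind (loop (nseq q tt)
    (fun=> BlackBox false (3, 0)%N (3, 0)%N (Return n tt))) (fun=>
  loop (nseq b tt) (fun=> BitOp andb junk junk junk (Return n tt)))).

Lemma costs_pad a q b : costs_exactly (pad a q b) a q b 0.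
Proof.
have H1 := @costs_exactly_loop n _ (nseq a tt)
  (fun=> FieldConst false (3, 0, 0)%N (Return n tt)) 1 0 0 0.
have H2 := @costs_exactly_loop n _ (nseq q tt)
  (fun=> BlackBox false (3, 0)%N (3, 0)%N (Return n tt)) 0 1 0 0.
have H3 := @costs_exactly_loop n _ (nseq b tt)
  (fun=> BitOp andb (3, 0, 0)%N (3, 0, 0)%N (3, 0, 0)%N (Return n tt)) 0 0 1 0.
rewrite !size_nseq !muln0 !muln1 in H1 H2 H3.
have h1 : costs_exactly (FieldConst false (3, 0, 0)%N (Return n tt)) 1 0 0 0.
  by [].
have h2 : costs_exactly (BlackBox false (3, 0)%N (3, 0)%N (Return n tt)) 0 1 0 0.
  by move=> *; split; rewrite //= mul1n addn0.
have h3 : costs_exactly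
    (BitOp andb (3, 0, 0)%N (3, 0, 0)%N (3, 0, 0)%N (Return n tt)) 0 0 1 0.
  by [].
have := costs_exactly_bind (H1 (fun=> h1)) (fun=> costs_exactly_bind (H2 (fun=> h2))
  (fun=> H3 (fun=> h3))).
by rewrite !addn0 !add0n; apply.
Qed.

(** In use, [t1] holds E, [t2] holds G and [tC] the transposed pivot rows of B. Hence C and R are
    read with their indices exchanged, and L and R come from the rows that [elt] lists after the [r]
    pivots. *)
Definition write_certificate s r (t1 tC t2 : nat) (ps : r.-tuple ('I_n * 'I_s))
    (qs : r.-tuple ('I_n * 'I_r)) : prog n unit :=
  let f l := (tnth ps l).1 in
  let g l := (tnth qs l).1 in
  bind (fill n 0 (fun (a : 'I_(n - r)) (l : 'I_r) =>
    EReg (t1, elt f (r + a), val (tnth ps l).2))) (fun=>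
  bind (fill n 1 (fun l l' : 'I_r => EReg (tC, val (g l'), val l))) (fun=>
  bind (fill n 2 (fun (l : 'I_r) (a : 'I_(n - r)) =>
    EReg (t2, elt g (r + a), val (tnth qs l).2))) (fun=>
  bind (write_bits 0 (pos f)) (fun=> write_bits 1 (fun a => elt g a))))).

(* The pivot rows of the operator matrix are obtained by applying its transpose
   to unit vectors, and are reduced in turn. *)
Definition row_stage s r (t1 : nat) (ps : r.-tuple ('I_n * 'I_s)) : prog n unit :=
  bind (fill n t1.+1 (fun (i : 'I_n) (l : 'I_r) => EConst (i == (tnth ps l).1)))
    (fun=>
  bind (apply_operator op n true t1.+1 t1.+2 r) (fun=>
  bind (eliminate t1.+2.+3 (enum 'I_r) [::]) (fun res =>
  if (insub res.2 : option (r.-tuple ('I_n * 'I_r))) is Some qs then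
    write_certificate t1 t1.+2.+3 res.1 ps qs
  else Return n tt))).

(** The draws U are in array 4, so B U arrives in array 8. The column beyond [k] is what reveals a
    rank exceeding [k]. *)
Definition check_after_draws k : prog n (option (reported_rank n k)) :=
  bind (apply_operator op n false 4 5 k.+1) (fun=>
  bind (eliminate 8 (enum 'I_k.+1) [::]) (fun res =>
  if (insub (size res.2) : option 'I_(minn n k).+1) is Some rho then
    if (insub res.2 : option ((val rho).-tuple ('I_n * 'I_k.+1))) is Some ps then
      bind (row_stage res.1 ps) (fun=> Return n (Some rho))
    else Return n None
  else Return n None)).

(** Padding comes first and is harmless there: the rest is correct from every initial state. *)
Definition check k : prog n (option (reported_rank n k)) :=
  bind (pad (n * k ^ 2) (k * up_log 2 n) (n * up_log 2 n)) (fun=>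
  bind (draw_matrix n 4 n k.+1) (fun=> check_after_draws k)).

Lemma costs_write_certificate s r t1 tC t2 ps qs :
  costs (@write_certificate s r t1 tC t2 ps qs)
    (8 * ((n - r) * r) + 4 * (r * r)) 0 (2 * (n * up_log 2 n)) 0.
Proof.
pose lg := up_log 2 n.
apply: costs_mono (_ : costs _
  ((n - r) * r * (2 + 2) + (r * r * (2 + 2) + (r * (n - r) * (2 + 2) + (0 + 0))))
  (0 + (0 + (0 + (0 + 0))))
  (0 + (0 + (0 + (n * lg + n * lg)))) (0 + (0 + (0 + (0 + 0))))) _ _ _; try lia.
do 3 (apply: costs_bind; first by [apply: costs_fill]; move=> _).
by apply: costs_bind => [|_]; apply: costs_write_bits.
Qed.

Lemma costs_row_stage s r t1 (ps : r.-tuple ('I_n * 'I_s)) :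
  costs (row_stage t1 ps) (n * r * 25 + n * r * r * 13 +
    (8 * ((n - r) * r) + 4 * (r * r))) (2 * r) (2 * (n * up_log 2 n)) 0.
Proof.
apply: costs_mono (_ : costs _
  (n * r * (1 + 2) + (n * r * 21 + (r * (n + n * r * 13) +
    (8 * ((n - r) * r) + 4 * (r * r)))))
  (0 + (2 * r + (0 + 0))) (0 + (0 + (0 + 2 * (n * up_log 2 n))))
  (0 + (0 + (0 + 0)))) _ _ _; try lia.
apply: costs_bind => [|_]; first exact: costs_fill.
apply: costs_bind => [|_]; first exact: costs_apply_operator.
apply: costs_bind => [|res].
  by have := costs_eliminate t1.+2.+3 (enum 'I_r) [::]; rewrite size_enum_ord; apply.
case: insub => [qs|]; first exact: costs_write_certificate.
exact: costs_mono (costs_Return _) _ _ _.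
Qed.

Lemma costs_check_after_draws k : (0 < k)%N ->
  costs (check_after_draws k) (150 * (n * k ^ 2)) (6 * k)
    (2 * (n * up_log 2 n)) 0.
Proof.
(* As k + 1 <= 2 k, the three stages cost at most 42, 54 and 50 = 25 + 13 + 8 + 4 times n k^2, and 2
   (k + 1) + 2 k <= 6 k products suffice. *)
move=> k0; apply: costs_mono (_ : costs _
  (n * k.+1 * 21 + (k.+1 * (n + n * k.+1 * 13) + 50 * (n * k ^ 2)))
  (2 * k.+1 + (0 + 2 * k)) (0 + (0 + 2 * (n * up_log 2 n)))
  (0 + (0 + 0))) _ _ _; [| |by lia|by lia].
  apply: costs_bind => [|_]; first exact: costs_apply_operator.
  apply: costs_bind => [|res].
    by have := costs_eliminate 8 (enum 'I_k.+1) [::]; rewrite size_enum_ord; apply.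
  have ret x : costs (Return n x : prog n (option (reported_rank n k)))
      (50 * (n * k ^ 2)) (2 * k) (2 * (n * up_log 2 n)) 0.
    exact: costs_mono (costs_Return _) _ _ _.
  case: insub => [rho|]; last exact: ret.
  case: insub => [ps|]; last exact: ret.
  have /andP [le_n le_k] : (val rho <= n)%N && (val rho <= k)%N.
    by rewrite -leq_min leq_ord.
  rewrite -[(50 * _)%N]addn0 -[(2 * k)%N]addn0 -[(2 * (n * _))%N]addn0.
  rewrite -[X in costs _ _ _ _ X]addn0.
  apply: costs_bind => [|_]; last exact: costs_Return.
  apply: costs_mono (costs_row_stage _ _) _ _ _ => //; last by rewrite leq_mul2l.
  move: (val rho) le_n le_k => r le_n le_k.
  have h1 : (n * r <= n * k ^ 2)%N.
    by rewrite leq_mul2l (leq_trans le_k) ?orbT // expnS leq_pmulr ?expn_gt0 ?k0.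
  have h2 : (n * r * r <= n * k ^ 2)%N.
    by rewrite -mulnA leq_mul2l mulnn leq_sqr le_k orbT.
  have h3 : ((n - r) * r <= n * r)%N by rewrite leq_mul2r leq_subr orbT.
  have h4 : (r * r <= n * r)%N by rewrite leq_mul2r le_n orbT.
  move: (n * r * r)%N ((n - r) * r)%N (r * r)%N (n * r)%N (n * k ^ 2)%N h1 h2 h3 h4.
  lia.
have h1 : (n * k <= n * k ^ 2)%N.
  by rewrite leq_mul2l expnS leq_pmulr ?orbT ?expn_gt0 ?k0.
have h2 : (n <= n * k)%N by rewrite leq_pmulr.
rewrite !expnS expn0 in h1 *; nia.
Qed.

Variables (F : fieldType) (A : 'M[F]_n) (mu : nat).
Let B := operator_matrix op A.
Implicit Types st : state F.

Lemma tri_write_certificate s r t1 tC t2 (ps : r.-tuple ('I_n * 'I_s))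
    (qs : r.-tuple ('I_n * 'I_r)) st :
  let f l := (tnth ps l).1 in
  let g l := (tnth qs l).1 in
  injective f -> injective g -> (3 < t1)%N -> (3 < tC)%N -> (3 < t2)%N ->
  tri A mu (write_certificate t1 tC t2 ps qs) st (fun _ st' =>
    let c := read_rep n r st' in
    (forall i, rep_p c i = pos f i) /\ (forall i : 'I_n, rep_q c i = elt g i)
    /\ [/\ rep_L c = \matrix_(a, l) freg st (t1, elt f (r + a), val (tnth ps l).2),
           rep_C c = \matrix_(l, l') freg st (tC, val (g l'), val l)
         & rep_R c = \matrix_(l, a) freg st (t2, elt g (r + a), val (tnth qs l).2)]).
Proof.
move=> f g injf injg lt1 ltC lt2.
apply: tri_bind; apply: tri_mono (tri_fill _ _ _ _ _) _ => //.
  by move=> a l; rewrite /= /only; lia.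
move=> _ st1 [e1 f1].
apply: tri_bind; apply: tri_mono (tri_fill _ _ _ _ _) _ => //.
  by move=> a l; rewrite /= /only; lia.
move=> _ st2 [e2 f2].
apply: tri_bind; apply: tri_mono (tri_fill _ _ _ _ _) _ => //.
  by move=> a l; rewrite /= /only; lia.
move=> _ st3 [e3 f3].
apply: tri_bind; apply: tri_mono (tri_write_bits _ _ _ _ _) _.
  exact: pos_lt.
move=> _ st4 [ef4 _ r4].
apply: tri_mono (tri_write_bits _ _ _ _ _) _; first exact: elt_lt.
move=> _ st5 [ef5 b5 r5]; split; last split; last split => /=.
- move=> i; rewrite /= -(r4 i); apply: eq_bigr => b _.
  by rewrite b5.
- by move=> i; exact: r5.
- rewrite ef5 ef4 -/(arr st3 0 (n - r) r).
  by rewrite (frame_arr _ _ f3) // (frame_arr _ _ f2) // e1.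
- rewrite ef5 ef4 -/(arr st3 1 r r) (frame_arr _ _ f3) // e2.
  by apply/matrixP => l l'; rewrite !mxE /= f1.1 //; rewrite /only; lia.
rewrite ef5 ef4 -/(arr st3 2 r (n - r)) e3.
by apply/matrixP => l a; rewrite !mxE /= f2.1 ?f1.1 //; rewrite /only; lia.
Qed.

(** The first hypotheses make the pivot columns in [t1] a basis E of the column space of B.
    Interpolating B and then its transposed pivot rows gives B = E C G^T with C the submatrix of B
    on the pivots. *)
Lemma tri_row_stage s r t1 (ps : r.-tuple ('I_n * 'I_s)) (le_rn : (r <= n)%N) st :
  (3 < t1)%N -> reduced (arr st t1 n s) [::] ps ->
  (B^T <= (arr st t1 n s)^T)%MS -> \rank B = r ->
  tri A mu (row_stage t1 ps) st (fun _ st' =>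
    let c := read_rep n r st' in
    correct_certificate le_rn B c && (rep_C c \in unitmx)).
Proof.
move=> lt1 red sub rkB; pose f l := (tnth ps l).1.
have basis := reduced_basis red; rewrite -/f in basis.
set E := \matrix_(_, _) _ in basis.
have eB : B = E *m rowsub f B := column_basis_interp basis sub.
have injf : injective f := column_basis_inj basis.
apply: tri_bind; apply: tri_mono (tri_fill _ _ _ _ _) _ => //; first by lia.
move=> _ st1 [e1 f1]; apply: tri_bind.
apply: tri_mono (tri_apply_operator _ _ _ _ _ _ _ _ _) _; try lia.
move=> _ st2 [e2 f2].
set M2 := (rowsub f B)^T.
(* The transpose of B is applied to the unit vectors at the pivot rows. *)
have {}e2 : arr st2 t1.+2.+3 n r = M2.
  rewrite e2 e1; apply/matrixP => i l; rewrite !mxE.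
  rewrite (bigD1 (f l)) //= big1 => [|x nx].
    by rewrite !mxE eqxx mulr1 addr0.
  by rewrite !mxE (negbTE nx) mulr0.
apply: tri_bind; apply: tri_mono (tri_eliminate _ _ _ _ _) _;
  [by lia|exact: enum_uniq|exact: reduced_start|].
move=> [t2 qs'] st3 /= [le2 f3 red2 sp2].
have rkM2 : \rank M2 = r.
  apply/eqP; rewrite eqn_leq mxrank_tr rank_leq_row -{1}rkB {1}eB.
  exact: mxrankM_maxr.
(* The pivot rows have rank [r], so elimination finds exactly [r] pivots and the size test
   succeeds. *)
have szq : size qs' == r.
  have := column_basis_rank (reduced_basis (ps := in_tuple qs') red2).
  by rewrite -mxrank_tr sp2 e2 mxrank_tr => <-; apply/eqP.
rewrite insubT /=; set qs := Sub qs' szq.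
have basis2' := reduced_basis (ps := qs) red2.
pose g l := (tnth qs l).1; rewrite -/g in basis2'.
set G := \matrix_(_, _) _ in basis2'.
have basis2 : column_basis M2 g G.
  by case: basis2' => G1 GM; split=> //; apply: eqmx_trans GM _; rewrite -e2.
have eM2 : M2 = G *m rowsub g M2 := column_basis_interp basis2 (submx_refl _).
have injg : injective g := column_basis_inj basis2.
apply: tri_mono (tri_write_certificate _ injf injg _ _ _) _; try lia.
move=> _ st4 [ep [eq [eL eC eR]]].
set c := read_rep _ _ _ in ep eq eL eC eR *.
have {}eC : rep_C c = (rowsub g M2)^T.
  rewrite eC -e2; apply/matrixP => l l'; rewrite !mxE f3.1 //.
  by rewrite /above; lia.
pose hE i (l : 'I_r) := freg st3 (t1, i, val (tnth ps l).2).
pose hG i (l : 'I_r) := freg st3 (t2, i, val (tnth qs l).2).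
have eE : E = \matrix_(i < n, l < r) hE i l.
  apply/matrixP => i l; rewrite !mxE /hE f3.1 ?f2.1 ?f1.1 //.
  - by rewrite /only; lia.
  - by rewrite /above; lia.
  by rewrite /above; lia.
have eG : G = \matrix_(i < n, l < r) hG i l.
  by apply/matrixP => i l; rewrite !mxE.
have val_c : rep_value le_rn c = E *m rep_C c *m G^T.
  rewrite eE eG; apply: (rep_value_bases _ injf injg _ _ ep eq eL eR).
  - by rewrite -eE; case: basis.
  by rewrite -eG; case: basis2.
have eBc : B = rep_value le_rn c.
  by rewrite val_c eC -mulmxA -trmx_mul -eM2 trmxK.
apply/andP; split; last first.
  (* C is nonsingular because B, a product with factor C, has rank [r]. *)
  rewrite -row_full_unit /row_full eqn_leq rank_leq_row -{1}rkB {1}eBc val_c.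
  by rewrite (leq_trans (mxrankM_maxl _ _)) ?mxrankM_maxr.
rewrite /correct_certificate; case: eqP => [r0|_].
  by rewrite -mxrank_eq0 rkB r0.
have [s1 [ps1 _]] := completion_perm injf.
have [s2 [_ es2]] := completion_perm injg.
rewrite !is_perm_index_mx {1}eBc eqxx andbT; apply/andP; split; apply/existsP.
  by exists s1; apply/forallP => i; rewrite ep ps1.
by exists (s2^-1)%g; apply/forallP => i; rewrite eq es2.
Qed.

(** Failure is paired with the deficient rank of B U, the event whose probability is bounded later.
    The zero counts are placeholders, as both predicates inspect only the leaf and the memory. *)
Lemma tri_check_after_draws k st :
  let M := B *m arr st 4 n k.+1 in
  tri A mu (check_after_draws k) st (fun x st' =>
    let o := Outcome x st' 0 0 0 in
    check_succeeds B o || estimate_too_low B o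
    && (\rank M != minn (\rank B) k.+1)).
Proof.
move=> M; apply: tri_bind.
apply: tri_mono (tri_apply_operator _ _ _ _ _ _ _ _ _) _ => //.
move=> _ st1 [e1 f1]; apply: tri_bind.
apply: tri_mono (tri_eliminate _ _ _ (enum_uniq _) (reduced_start _)) _ => //.
move=> [t1 ps'] st2 [le1 f2 red sp]; rewrite [_.1]/= [_.2]/= in le1 red sp *.
rewrite e1 -/M in sp.
have szp : \rank M = size ps'.
  have := column_basis_rank (reduced_basis (ps := in_tuple ps') red).
  by rewrite -mxrank_tr sp mxrank_tr.
have leB : (\rank M <= \rank B)%N by exact: mxrankM_maxl.
have len : (\rank M <= n)%N by exact: rank_leq_row.
have lek : (\rank M <= k.+1)%N by exact: rank_leq_col.
case: insubP => [rho _ erho|]; last first.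
  (* More than min(n, k) pivots were found; since their number is at most n, the rank exceeds k. *)
  move=> gt_k tape; apply/orP; left; rewrite /check_succeeds /=.
  apply: leq_trans leB; rewrite szp in len *.
  by move: gt_k; rewrite ltnS leq_min len -ltnNge.
have szr : size ps' == val rho by rewrite erho.
rewrite insubT /=; set ps := Sub ps' szr; apply: tri_bind.
have [eq_rk|ne_rk] := eqVneq (\rank M) (\rank B); last first.
  (* The pivot count is below rank B and at most k, hence below min(rank B, k + 1). *)
  move=> tape /= tape'; apply/orP; right; rewrite /estimate_too_low /=.
  have le_k := leq_trans (ltn_ord rho) (geq_minr n k : (minn n k).+1 <= k.+1)%N.
  have lt : (rho < \rank B)%N.
    by rewrite -[nat_of_ord rho]/(val rho) erho -szp ltn_neqAle ne_rk.
  rewrite lt /= szp -erho neq_ltn leq_min; apply/orP; left.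
  by rewrite lt.
have rkB : \rank B = val rho by rewrite -eq_rk szp erho.
(* The column space of B U lies in that of B, and equal ranks make them coincide. *)
have subB : (B^T <= (arr st2 t1 n k.+1)^T)%MS.
  rewrite sp; have := mxrank_leqif_sup (_ : (M^T <= B^T)%MS).
  rewrite trmx_mul => /(_ (submxMl _ _)) [_].
  by rewrite -trmx_mul !mxrank_tr eq_rk eqxx => <-.
have lt1 : (3 < t1)%N by lia.
have H := tri_row_stage (ps := ps) (reported_rank_le rho) lt1 red subB rkB.
apply: tri_mono H _.
move=> _ st3 cert tape; apply/orP; left.
by rewrite /check_succeeds /= rkB eqxx.
Qed.

End Programs.

(** * The verification *)

Section Verification.
Variables (op : displacement) (n : nat).

Definition zero_test (t : nat) : prog n bool :=
  bind (mapM (fun i : 'I_n =>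
          FieldTest (t, val i, 0%N) (Return n true) (Return n false))
          (enum 'I_n))
    (fun bs => Return n (all id bs)).

(* Leaves in array 12 the vector in array 8 minus the product of the claimed
   representation, read from arrays 0 to 2, with the vector in array 4. *)
Definition residual (r : nat) (p q : 'I_n -> nat) : prog n unit :=
  let id_or (x : nat) (l : 'I_r) (e : fexpr) :=
    if (x < r)%N then EConst (x == val l) else e in
  bind (fill n 9 (fun (l : 'I_r) (_ : 'I_1) => esum (enum 'I_n) (fun x =>
    EOp FMul (id_or x l (EReg (2, val l, x - r)))%N (EReg (4, q x, 0))))) (fun=>
  bind (fill n 10 (fun (l : 'I_r) (_ : 'I_1) => esum (enum 'I_r) (fun l' =>
    EOp FMul (EReg (1, val l, val l')) (EReg (9, val l', 0))))) (fun=>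
  bind (fill n 11 (fun (x : 'I_n) (_ : 'I_1) => esum (enum 'I_r) (fun l =>
    EOp FMul (id_or x l (EReg (0, x - r, val l)))%N (EReg (10, val l, 0))))) (fun=>
  fill n 12 (fun (i : 'I_n) (_ : 'I_1) =>
    EOp FSub (EReg (8, val i, 0)) (EReg (11, p i, 0)))))).

(** The permutation test precedes [residual], which uses the vectors as addresses; applying P and Q
    thus needs no matrix arithmetic. *)
Definition verify_after_draws (r : nat) : prog n bool :=
  bind (apply_operator op n false 4 5 1) (fun=>
  if r == 0%N then zero_test 8 else
  bind (read_bits n 0) (fun ps => bind (read_bits n 1) (fun qs =>
  let p (i : 'I_n) := nth 0 ps i in
  let q (i : 'I_n) := nth 0 qs i in
  if is_perm_fun p && is_perm_fun q then
    bind (residual r p q) (fun=> zero_test 12)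
  else Return n false))).

(** Here the padding follows the decision, so it cannot disturb the certificate in memory. *)
Definition verify k (rho : reported_rank n k) : prog n bool :=
  bind (bind (draw_matrix n 4 n 1) (fun=> verify_after_draws rho)) (fun b =>
  bind (pad n (n * k) 1 (n * up_log 2 n)) (fun=> Return n b)).

Lemma costs_zero_test t : costs (zero_test t) n 0 0 0.
Proof.
rewrite /zero_test; set f := fun i : 'I_n => _.
have H := @costs_mapM n _ _ f (enum 'I_n) 1 0 0 0.
rewrite size_enum_ord !muln0 muln1 in H.
rewrite -[X in costs _ X]addn0.
apply: (costs_bind (q := 0) (q' := 0) (b := 0) (b' := 0) (d := 0) (d' := 0)) => //.
by apply: H => i F A mu st tape; rewrite /f /=; case: ifP.
Qed.

Lemma costs_residual r p q : (r <= n)%N ->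
  costs (residual r p q) (n * r * 27 + n * 10) 0 0 0.
Proof.
move=> le_rn; apply: costs_mono (_ : costs _
  (r * 1 * (n * 6 + 1 + 2) + (r * 1 * (r * 6 + 1 + 2) +
    (n * 1 * (r * 6 + 1 + 2) + n * 1 * (5 + 2))))
  (0 + (0 + (0 + 0))) (0 + (0 + (0 + 0))) (0 + (0 + (0 + 0)))) _ _ _; try by [].
  apply: costs_bind => [|_].
    apply: costs_fill => l _; rewrite -[X in (X * 6)%N]size_enum_ord.
    by apply: esize_esum => x /=; case: ifP.
  apply: costs_bind => [|_].
    apply: costs_fill => l _; rewrite -[X in (X * 6)%N]size_enum_ord.
    exact: esize_esum.
  apply: costs_bind => [|_]; last exact: costs_fill.
  apply: costs_fill => l _; rewrite -[X in (X * 6)%N]size_enum_ord.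
  by apply: esize_esum => x /=; case: ifP.
have h1 : (r * r <= n * r)%N by rewrite leq_mul2r le_rn orbT.
case: r le_rn h1 => [|r] le_rn h1; nia.
Qed.

Lemma costs_verify_after_draws r k : (0 < k)%N -> (r <= n)%N -> (r <= k)%N ->
  costs (verify_after_draws r) (60 * (n * k)) 2 (2 * (n * up_log 2 n)) 0.
Proof.
move=> k0 le_rn le_rk; apply: costs_mono (_ : costs _
  (n * 1 * 21 + (0 + (0 + (n * r * 27 + n * 10 + n))))
  (2 * 1 + (0 + (0 + (0 + 0)))) (0 + (n * up_log 2 n + (n * up_log 2 n + (0 + 0))))
  (0 + (0 + (0 + (0 + 0))))) _ _ _; [| |by []|by lia].
  apply: costs_bind => [|_]; first exact: costs_apply_operator.
  case: (r == 0%N).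
    by apply: costs_mono (costs_zero_test _) _ _ _ => //; lia.
  apply: costs_bind => [|ps]; first exact: costs_read_bits.
  apply: costs_bind => [|qs]; first exact: costs_read_bits.
  cbv zeta; case: (_ && _); last exact: costs_mono (costs_Return _) _ _ _.
  apply: costs_bind => [|_]; first exact: costs_residual.
  exact: costs_zero_test.
have h1 : (n * r <= n * k)%N by rewrite leq_mul2l le_rk orbT.
have h2 : (n <= n * k)%N by rewrite leq_pmulr.
lia.
Qed.

Variables (F : fieldType) (A : 'M[F]_n) (mu : nat).
Let B := operator_matrix op A.
Implicit Types st : state F.

Lemma reads_zero_test t st : reads A mu (zero_test t) st (arr st t n 1 == 0).
Proof.
apply: reads_bind (reads_mapM (g := fun i : 'I_n => freg st (t, val i, 0%N) == 0)
    _ _) _ => [i tape|tape] /=; first by case: ifP.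
split=> //; rewrite all_map; apply/allP/eqP => [z|/matrixP z].
  by apply/matrixP => i j; rewrite ord1 !mxE; apply/eqP/z; rewrite mem_enum.
by move=> i _; have := z i 0; rewrite !mxE /= => ->.
Qed.

(** The representation is applied to the vector from right to left, so only matrix-vector products
    occur, at a cost of O(n r + n). *)
Lemma tri_residual r (le_rn : (r <= n)%N) (p q : 'I_n -> nat) st :
  is_perm_fun p -> is_perm_fun q ->
  let c := read_rep n r st in
  (forall i, rep_p c i = p i) -> (forall i, rep_q c i = q i) ->
  tri A mu (residual r p q) st (fun _ st' =>
    arr st' 12 n 1 = arr st 8 n 1 - rep_value le_rn c *m arr st 4 n 1).
Proof.
move=> /existsP [sp /forallP pP] /existsP [sq /forallP qP] c cp cq.
have lt_p i : (p i < n)%N by rewrite (eqP (pP i)) ltn_ord.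
have lt_q i : (q i < n)%N by rewrite (eqP (qP i)) ltn_ord.
pose v := arr st 4 n 1.
(* [X1] is the block column of the identity and L, and [X2] the transpose of the block row of the
   identity and R. *)
pose X1 := \matrix_(x < n, l < r)
  if (x < r)%N then (x == l :> nat)%:R else freg st (0, x - r, val l)%N.
pose X2 := \matrix_(x < n, l < r)
  if (x < r)%N then (x == l :> nat)%:R else freg st (2, val l, x - r)%N.
have eq_rep : rep_value le_rn c *m v
    = index_mx F p *m (X1 *m (rep_C c *m (X2^T *m (index_mx F q *m v)))).
  rewrite /rep_value (castmx_col_mx le_rn (fun a l => freg st (0, a, val l)%N)).
  rewrite (castmx_row_mx le_rn (fun a l => freg st (2, val l, a)%N)).
  have -> : index_mx F (rep_p c) = index_mx F p.
    by apply/matrixP => i j; rewrite !mxE cp.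
  have -> : index_mx F (rep_q c) = index_mx F q.
    by apply/matrixP => i j; rewrite !mxE cq.
  by rewrite -/X1 -/X2 !mulmxA.
have pick_p m (M : 'M[F]_(n, m)) i j :
    (index_mx F p *m M) i j = M (Ordinal (lt_p i)) j.
  rewrite mxE (bigD1 (Ordinal (lt_p i))) //= big1 => [|x nx].
    by rewrite mxE eqxx mul1r addr0.
  by rewrite mxE; case: eqP => [e|_]; [case/eqP: nx; apply: val_inj|rewrite mul0r].
have pick_q m (M : 'M[F]_(n, m)) i j :
    (index_mx F q *m M) i j = M (Ordinal (lt_q i)) j.
  rewrite mxE (bigD1 (Ordinal (lt_q i))) //= big1 => [|x nx].
    by rewrite mxE eqxx mul1r addr0.
  by rewrite mxE; case: eqP => [e|_]; [case/eqP: nx; apply: val_inj|rewrite mul0r].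
apply: tri_bind; apply: tri_mono (tri_fill _ _ _ _ _) _ => //.
  by move=> l j; apply: avoids_esum => x /=; case: ifP.
move=> _ st1 [e1 f1].
have {}e1 : arr st1 9 r 1 = X2^T *m (index_mx F q *m v).
  rewrite e1; apply/matrixP => l j; rewrite ord1 mxE eval_esum big_enum.
  rewrite [RHS]mxE; apply: eq_bigr => x _.
  by rewrite pick_q !mxE /=; case: ifP.
apply: tri_bind; apply: tri_mono (tri_fill _ _ _ _ _) _ => //.
  by move=> l j; apply: avoids_esum.
move=> _ st2 [e2 f2].
have {}e2 : arr st2 10 r 1 = rep_C c *m (X2^T *m (index_mx F q *m v)).
  rewrite e2 -e1; apply/matrixP => l j; rewrite ord1 mxE eval_esum big_enum.
  by rewrite [RHS]mxE; apply: eq_bigr => x _; rewrite !mxE /= f1.1.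
apply: tri_bind; apply: tri_mono (tri_fill _ _ _ _ _) _ => //.
  by move=> x j; apply: avoids_esum => l /=; case: ifP.
move=> _ st3 [e3 f3].
have {}e3 : arr st3 11 n 1
    = X1 *m (rep_C c *m (X2^T *m (index_mx F q *m v))).
  rewrite e3 -e2; apply/matrixP => x j; rewrite ord1 mxE eval_esum big_enum.
  rewrite [RHS]mxE; apply: eq_bigr => l _; rewrite !mxE /=.
  by case: ifP => //= _; rewrite f2.1 ?f1.1.
apply: tri_mono (tri_fill _ _ _ _ _) _ => // _ st4 [e4 _].
rewrite e4 eq_rep -e3; apply/matrixP => i j; rewrite ord1 mxE [RHS]mxE [in RHS]mxE.
by rewrite [X in _ = _ + X]mxE pick_p mxE /= f3.1 ?f2.1 ?f1.1.
Qed.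

(** Correctness splits into well-formedness, decided exactly, and equality with this matrix, tested
    at random. For rank 0 the memory contents do not affect the claim. *)
Definition claim r (le_rn : (r <= n)%N) (c : representation F n r) : 'M[F]_n :=
  if r == 0%N then 0 else rep_value le_rn c.

Definition well_formed r (c : representation F n r) : bool :=
  (r == 0%N) || is_perm_fun (rep_p c) && is_perm_fun (rep_q c).

Lemma correct_certificateE r (le_rn : (r <= n)%N) (c : representation F n r) :
  correct_certificate le_rn B c = well_formed c && (B == claim le_rn c).
Proof.
rewrite /correct_certificate /well_formed /claim !is_perm_index_mx.
by case: eqP => //= _; rewrite andbA.
Qed.

Lemma tri_verify_after_draws r (le_rn : (r <= n)%N) st :
  let c := read_rep n r st in
  tri A mu (verify_after_draws r) st (fun b _ =>
    b = well_formed c && ((B - claim le_rn c) *m arr st 4 n 1 == 0)).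
Proof.
move=> c; apply: tri_bind.
apply: tri_mono (tri_apply_operator _ _ _ _ _ _ _ _ _) _ => //.
move=> _ st1 [e1 f1]; rewrite /well_formed /claim.
case: eqP => [_|_] /=.
  apply: tri_mono (reads_zero_test _ _) _ => b _ [-> _].
  by rewrite e1 subr0.
have eq_c : read_rep n r st1 = c by apply: (frame_read_rep _ _ f1).
have eq_p (i : 'I_n) : nth 0 [seq read_index n st1 0 (val x) | x <- enum 'I_n] i
    = rep_p c i.
  by rewrite (nth_map i) ?size_enum_ord // nth_ord_enum -eq_c.
have eq_q (i : 'I_n) : nth 0 [seq read_index n st1 1 (val x) | x <- enum 'I_n] i
    = rep_q c i.
  by rewrite (nth_map i) ?size_enum_ord // nth_ord_enum -eq_c.
apply: reads_bind (reads_read_bits _ _ _ _) _.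
apply: reads_bind (reads_read_bits _ _ _ _) _; cbv zeta.
have eq_perm (p p' : 'I_n -> nat) : p =1 p' -> is_perm_fun p = is_perm_fun p'.
  by move=> e; apply: eq_existsb => s; apply: eq_forallb => i; rewrite e.
rewrite (eq_perm _ _ eq_p) (eq_perm _ _ eq_q).
case: ifP => [/andP [pp pq]|_] /=; last by [].
apply: tri_bind; apply: tri_mono (tri_residual (r := r) le_rn _ _ _ _) _.
- by rewrite (eq_perm _ _ eq_p).
- by rewrite (eq_perm _ _ eq_q).
- by move=> i; rewrite eq_p eq_c.
- by move=> i; rewrite eq_q eq_c.
move=> _ st2 e2; apply: tri_mono (reads_zero_test _ _) _ => b _ [-> _].
by rewrite e2 e1 eq_c mulmxBl (frame_arr _ _ f1).
Qed.

End Verification.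

(** * Counting tapes *)

Section Counting.
Variable T : finType.
Implicit Types f g : seq T -> nat.

(** Nested sums over the successive draws allow conditioning on the first ones by plain
    induction. *)
Fixpoint tsum (N : nat) f : nat :=
  if N is N'.+1 then (\sum_(x : T) tsum N' (fun t => f (x :: t)))%N else f [::].

Lemma tsumE N f : (\sum_(t : N.-tuple T) f t)%N = tsum N f.
Proof.
elim: N f => [|N IH] f /=.
  rewrite (big_pred1 [tuple]) // => t.
  by rewrite [t]tuple0; apply/esym/eqP.
rewrite [RHS](eq_bigr (fun x : T => \sum_(t : N.-tuple T) f (x :: t))%N); last first.
  by move=> x _; rewrite -(IH (fun t => f (x :: t))).
rewrite pair_big /=.
rewrite (reindex (fun t : N.+1.-tuple T => (thead t, [tuple of behead t]))) /=.
  by apply: eq_bigr => t _; rewrite [in LHS](tuple_eta t).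
exists (fun x : T * N.-tuple T => [tuple of x.1 :: x.2]) => [t _|[x t] _].
  by rewrite [RHS]tuple_eta.
by rewrite theadE; congr pair; apply: val_inj.
Qed.

Lemma tsum_cat N M f :
  tsum (N + M) f = tsum N (fun t => tsum M (fun t' => f (t ++ t'))).
Proof.
by elim: N f => [|N IH] f //=; apply: eq_bigr => x _; rewrite IH.
Qed.

Lemma leq_tsum N f g : (forall t, size t = N -> f t <= g t)%N ->
  (tsum N f <= tsum N g)%N.
Proof.
elim: N f g => [|N IH] f g le_fg /=; first exact: le_fg.
by apply: leq_sum => x _; apply: IH => t st; apply: le_fg; rewrite /= st.
Qed.

Lemma eq_tsum N f g : f =1 g -> tsum N f = tsum N g.
Proof.
elim: N f g => [|N IH] f g eq_fg /=; first exact: eq_fg.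
by apply: eq_bigr => x _; apply: IH => t; apply: eq_fg.
Qed.

Lemma tsum_const N c : tsum N (fun=> c) = (#|T| ^ N * c)%N.
Proof.
by elim: N => [|N IH] /=; rewrite ?mul1n // sum_nat_const IH expnS mulnA.
Qed.

Lemma tsumD N f g : tsum N (fun t => f t + g t)%N = (tsum N f + tsum N g)%N.
Proof.
elim: N f g => [|N IH] f g //=.
by rewrite -big_split; apply: eq_bigr => x _; rewrite IH.
Qed.

Lemma tsumM N c f : tsum N (fun t => c * f t)%N = (c * tsum N f)%N.
Proof.
elim: N f => [|N IH] f //=.
by rewrite big_distrr; apply: eq_bigr => x _; rewrite IH.
Qed.

Variables (F : fieldType) (phi : T -> F).
Hypothesis phi_inj : injective phi.

(** The linear case of the Schwartz-Zippel bound, free of division: with the other draws fixed, at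
    most one value of a draw with nonzero coefficient solves the equation. *)
Lemma count_linear N (a : nat -> F) (b : F) :
  (exists2 i, (i < N)%N & a i != 0) ->
  (#|T| * tsum N (fun t => (\sum_(i < N) a i * [seq phi x | x <- t]`_i == b)%R)
   <= #|T| ^ N)%N.
Proof.
elim: N a b => [|N IH] a b; first by case.
move=> nz; rewrite /= expnS.
under eq_bigr => x _ do under eq_tsum => t do rewrite big_ord_recl /=.
have [/existsP [i nzi]|/existsPn z] := boolP [exists i : 'I_N, a i.+1 != 0].
  (* A later coefficient is nonzero: fix the first draw and move its term to the right-hand side. *)
  rewrite big_distrr -sum_nat_const leq_sum //= => x _.
  have nz' : (exists2 i, (i < N)%N & a i.+1 != 0) by exists i.
  apply: leq_trans (IH (fun i => a i.+1) (b - a 0%N * phi x) nz').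
  rewrite leq_mul2l; apply/orP; right; apply: leq_tsum => t _.
  by rewrite [in X in (_ <= X)%N]eq_sym subr_eq eq_sym addrC.
have nz0 : a 0%N != 0.
  case: nz => -[|i] // lt_i nzi; have := z (Ordinal (lt_i : (i < N)%N)).
  by rewrite nzi.
rewrite leq_mul2l; apply/orP; right.
(* Only the first coefficient is nonzero, so by injectivity of [phi] at most one first draw is a
   solution, and the other draws are free. *)
pose P := [pred x | (a 0%N * phi x == b)%R]; have le1 : (#|P| <= 1)%N.
  apply/card_le1P => x; rewrite inE => /eqP ex y; rewrite !inE.
  apply/eqP/eqP => [|-> //]; rewrite -ex => /(mulfI nz0).
  exact: phi_inj.
apply: leq_trans (_ : #|T| ^ N * 1 <= _)%N; last by rewrite muln1.
apply: leq_trans (leq_mul (leqnn _) le1).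
rewrite -(sum1_card P) big_distrr [X in (_ <= X)%N]big_mkcond /=.
apply: leq_sum => x _.
under eq_tsum => t.
  rewrite big1 ?addr0; last first.
    by move=> i _; have := z i; rewrite negbK => /eqP ->; rewrite mul0r.
  over.
by rewrite tsum_const /P inE; case: ifP => _; rewrite ?muln0.
Qed.

(** The transpose of the drawn matrix: each row is one drawn column, as suits row spaces. *)
Definition tape_mx (s n : nat) (tape : seq F) : 'M[F]_(s, n) :=
  \matrix_(j, i) tape`_(j * n + i).

(** Induction on the rows still to be drawn, with [W] the space reached so far. While [W] is smaller
    than [G], the next row fails to raise the rank only if a fixed nonzero linear form vanishes on
    it; a union bound over the missing dimensions gives the factor. *)
Lemma count_rank n s (G W : 'M[F]_n) : (W <= G)%MS ->
  (#|T| * tsum (s * n) (fun t =>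
     \rank (W + tape_mx s n [seq phi x | x <- t] *m G)%MS
       != minn (\rank G) (\rank W + s))
   <= (minn (\rank G) (\rank W + s) - \rank W) * #|T| ^ (s * n))%N.
Proof.
elim: s W => [|s IH] W leWG.
  have /minn_idPr leW := mxrankS leWG.
  by rewrite /= [tape_mx _ _ _]flatmx0 mul0mx addsmx0 addn0 leW eqxx muln0.
have [le_rk|lt_rk] := leqP (\rank G) (\rank W).
  under eq_tsum => t.
    have -> : \rank (W + tape_mx s.+1 n [seq phi x | x <- t] *m G)%MS = \rank G.
      apply/eqP; rewrite eqn_leq (leq_trans le_rk) ?mxrankS ?addsmxSl //.
      by rewrite addsmx_sub leWG submxMl.
    rewrite (minn_idPl _) ?eqxx /=; last by rewrite (leq_trans le_rk) ?leq_addr.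
    over.
  by rewrite tsum_const !muln0.
(* Since [G] is not contained in [W], some column of the cokernel of [W] is not annihilated by
   [G]. *)
have [j nzj] : exists j, col j (G *m cokermx W) != 0.
  apply/existsP; apply: contraLR lt_rk => /existsPn z; rewrite -leqNgt.
  apply: mxrankS; rewrite submxE; apply/eqP/matrixP => i j.
  have := z j; rewrite negbK => /eqP /matrixP /(_ i 0).
  by rewrite !mxE.
pose a : 'cV[F]_n := col j (cokermx W).
have Wa : W *m a = 0 by rewrite /a colE mulmxA mulmx_coker mul0mx.
have Ga : G *m a != 0 by rewrite /a colE mulmxA -colE.
(* The vector G a, extended by zero to all natural indices. *)
pose al i := if insub i is Some i' then (G *m a) (i' : 'I_n) 0 else 0.
have alE (i : 'I_n) : al i = (G *m a) i 0 by rewrite /al valK.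
have {}nzj : exists2 i, (i < n)%N & al i != 0.
  have /existsP [i nzi] : [exists i, (G *m a) i 0 != 0].
    apply: contraNT Ga => /existsPn z; apply/eqP/matrixP => i k.
    by rewrite ord1 [RHS]mxE; apply/eqP; rewrite -[_ == _]negbK z.
  by exists i; rewrite ?ltn_ord // alE.
pose bad (t : seq T) := (\sum_(i < n) al i * [seq phi x | x <- t]`_i == 0)%R.
have count_bad := count_linear 0 nzj.
set w := \rank W in lt_rk *; set m := minn _ _.
have le_w : (w < m)%N by rewrite leq_min lt_rk addnS ltnS leq_addr.
rewrite mulSn tsum_cat.
(* A bad first row is charged for all its continuations; after a good one the induction hypothesis
   applies with one dimension fewer missing. *)
have step t1 : size t1 = n ->
    (#|T| * tsum (s * n) (fun t2 => \rank (W + tape_mx s.+1 n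
        [seq phi x | x <- t1 ++ t2] *m G)%MS != m)
     <= #|T| * #|T| ^ (s * n) * bad t1 + (m - w.+1) * #|T| ^ (s * n))%N.
  move=> st1; case: (boolP (bad t1)) => [_|good].
    rewrite muln1; apply: leq_trans (leq_addr _ _); rewrite leq_mul2l.
    apply/orP; right; rewrite -[X in (_ <= X)%N]muln1 -tsum_const.
    by apply: leq_tsum => t _; case: (_ != _).
  rewrite muln0 add0n; pose y : 'rV[F]_n := \row_i [seq phi x | x <- t1]`_i.
  pose W1 := (W + y *m G)%MS.
  have leW1 : (W1 <= G)%MS by rewrite addsmx_sub leWG submxMl.
  have rkW1 : \rank W1 = w.+1.
    apply/eqP; rewrite eqn_leq; apply/andP; split.
      apply: leq_trans (mxrank_adds_leqif _ _).1 _.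
      by rewrite -[w.+1]addn1 leq_add2l rank_leq_row.
    have := mxrank_leqif_sup (addsmxSl W (y *m G)) => -[le eq].
    rewrite ltn_neqAle le andbT eq addsmx_sub submx_refl /=.
    (* If y G lay in [W], then y G a would vanish because W a = 0, and the row would be bad. *)
    apply: contra good => /submxP [X eX].
    have : (y *m (G *m a)) 0 0 = 0 by rewrite mulmxA eX -mulmxA Wa mulmx0 mxE.
    rewrite mxE => e0; apply/eqP; rewrite -[RHS]e0; apply: eq_bigr => i _.
    by rewrite alE [y 0 i]mxE mulrC.
  (* The rank gained makes up for the row used, so the target [m] is unchanged. *)
  have := IH W1 leW1; rewrite rkW1 addSnnS -/m.
  congr (_ * _ <= _)%N; apply: eq_tsum => t2; congr (nat_of_bool (_ != _)).
  have -> : tape_mx s.+1 n [seq phi x | x <- t1 ++ t2]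
      = col_mx y (tape_mx s n [seq phi x | x <- t2]) :> 'M_(1 + s, n).
    apply/matrixP => i k; rewrite [RHS]mxE mxE map_cat nth_cat size_map st1.
    case: splitP => i' ->; rewrite ?ord1 /= mxE ?mul0n ?add0n ?ltn_ord //.
    rewrite mulSn -addnA ltnNge leq_addr /=; congr (_`_ _).
    by rewrite addKn.
  rewrite (@mul_col_mx _ 1 s).
  rewrite -addsmxA; apply/eqmx_rank/eqmxP.
  exact: adds_eqmx (eqmx_refl W) (addsmxE _ _).
rewrite -tsumM; apply: leq_trans (leq_tsum step) _.
rewrite tsumD tsum_const tsumM.
have -> : (m - w = (m - w.+1).+1)%N by rewrite subnSK.
rewrite mulSn expnD leq_add //.
  rewrite mulnAC leq_mul2r; apply/orP; right.
  exact: count_bad.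
by rewrite mulnCA.
Qed.

End Counting.

Lemma prob_le (F : fieldType) (S : {fset F}) N (E : seq F -> bool) m :
  S != fset0 ->
  (#|{: S}| * tsum N (fun t : seq S => E [seq val x | x <- t]) <= m * #|{: S}| ^ N)%N ->
  prob S N E <= m%:R / #|` S|%:R.
Proof.
move=> nS; rewrite /prob card_tuple cardfE -tsumE => le_m.
have S0 : (0 < #|{: S}|)%N by rewrite -cardfE cardfs_gt0.
rewrite -sum1_card big_mkcond /=.
under eq_bigr => t _ do rewrite inE.
have {le_m} : (#|{: S}|
      * (\sum_(t : N.-tuple S) (if E [seq val s | s <- t] then 1 else 0))
    <= m * #|{: S}| ^ N)%N.
  apply: leq_trans le_m; rewrite leq_mul2l; apply/orP; right.
  by apply: leq_sum => t _; case: ifP.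
move: (\sum_t _)%N => x le_m.
rewrite ler_pdivrMr ?ltr0n ?expn_gt0 ?S0 // mulrAC ler_pdivlMr ?ltr0n //.
by rewrite -!natrM ler_nat mulnC.
Qed.

(** * Costs and error probabilities *)

Section Guarantees.
Variables (op : displacement) (F : fieldType) (n k mu : nat) (A : 'M[F]_n).
Hypothesis k_gt0 : (0 < k)%N.
Let B := operator_matrix op A.

(** The lower bounds come from the exactly counted padding alone; the upper bounds add the costs of
    the draws and the remaining stages. *)
Lemma check_costs st tape :
  let o := run A mu (check op n k) st tape in
  [/\ (n * k ^ 2 + mu * k * up_log 2 n <= arith_ops o)%N,
      (arith_ops o <= 151 * (n * k ^ 2) + (k * up_log 2 n + 6 * k) * mu)%N,
      (n * up_log 2 n <= bit_ops o <= 3 * (n * up_log 2 n))%N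
    & draws o = (k.+1 * n)%N].
Proof.
rewrite /check run_bind /=.
have [-> -> ->] := costs_pad (n * k ^ 2) (k * up_log 2 n) (n * up_log 2 n) A mu st tape.
set st' := final _.
have [a b ->] := costs_bind (costs_draw_matrix (n := n) 4 n k.+1)
  (fun=> costs_check_after_draws op k_gt0) A mu st' (drop 0 tape).
set o := run _ _ _ _ _ in a b *.
have mulE : (mu * k * up_log 2 n = k * up_log 2 n * mu)%N by lia.
rewrite mulE; split; [exact: leq_addr| |apply/andP; split; [exact: leq_addr|]|lia].
  by rewrite mulnDl; lia.
by lia.
Qed.

(** Failure is reduced to a condition on the tape and B, which can be counted without reference to
    the program. *)
Lemma check_spec st tape :
  check_succeeds B (run A mu (check op n k) st tape)
  || estimate_too_low B (run A mu (check op n k) st tape)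
  && (\rank (tape_mx k.+1 n tape *m B^T) != minn (\rank B) k.+1).
Proof.
set o := run _ _ _ _ _.
pose st1 := final (run A mu (pad n (n * k ^ 2) (k * up_log 2 n)
  (n * up_log 2 n)) st tape).
pose st2 := final (run A mu (draw_matrix n 4 n k.+1) st1 tape).
pose o' := run A mu (check_after_draws op n k) st2 (drop (k.+1 * n) tape).
(* The padding draws nothing, so the matrix is filled from the start of the tape. *)
have [lo fo] : leaf o = leaf o' /\ final o = final o'.
  rewrite /o /check run_bind /=.
  have [_ _ ->] := costs_pad (n * k ^ 2) (k * up_log 2 n) (n * up_log 2 n)
    A mu st tape.
  rewrite drop0 run_bind /=.
  by have [_ _ ->] := costs_draw_matrix (n := n) 4 n k.+1 A mu st1 tape.
have := tri_check_after_draws op A mu k st2 (drop (k.+1 * n) tape).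
rewrite /check_succeeds /estimate_too_low lo fo /=.
have [-> _] := run_draw_matrix A mu 4 n k.+1 st1 tape.
rewrite -[\rank (_ *m \matrix_(_, _) _)]mxrank_tr trmx_mul.
have -> // : (\matrix_(i < n, j < k.+1) tape`_(j * n + i))^T = tape_mx k.+1 n tape.
by apply/matrixP => i j; rewrite !mxE.
Qed.

Lemma check_prob (S : {fset F}) st : S != fset0 ->
  prob S (k.+1 * n)
    (fun t => ~~ check_succeeds B (run A mu (check op n k) st t))
  <= (minn (\rank B) k + 1)%:R / #|` S|%:R.
Proof.
move=> nS; apply: prob_le => //.
have := count_rank (phi := (val : S -> F)) val_inj k.+1 (sub0mx n B^T).
rewrite mxrank0 add0n subn0 mxrank_tr => bound.
apply: leq_trans (leq_trans _ bound) _; last first.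
  (* Starting from the zero space, the factor is min(r, k + 1), at most min(r, k) + 1. *)
  by rewrite leq_mul2r; apply/orP; right; rewrite !minnE; lia.
rewrite leq_mul2l; apply/orP; right; apply: leq_tsum => t _.
rewrite adds0mx; move: (check_spec st [seq val x | x <- t]).
by case: check_succeeds => //= /andP [_ ->].
Qed.

Lemma verify_costs (rho : reported_rank n k) st tape :
  let o := run A mu (verify op rho) st tape in
  [/\ (n * k + mu <= arith_ops o <= 61 * (n * k) + 3 * mu)%N,
      (n * up_log 2 n <= bit_ops o <= 3 * (n * up_log 2 n))%N & draws o = n].
Proof.
have [le_n le_k] : (rho <= n)%N /\ (rho <= k)%N.
  by apply/andP; rewrite -leq_min leq_ord.
rewrite /verify run_bind /=.
have [a b ->] := costs_bind (costs_draw_matrix (n := n) 4 n 1)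
  (fun=> costs_verify_after_draws op k_gt0 le_n le_k) A mu st tape.
set o := run _ _ _ _ _ in a b *; rewrite run_bind /=.
have [-> -> ->] := costs_pad (n * k) 1 (n * up_log 2 n) A mu (final o)
  (drop (1 * n + 0) tape).
by split; lia.
Qed.

Lemma verify_spec (rho : reported_rank n k) st tape :
  let c := read_rep n rho st in
  leaf (run A mu (verify op rho) st tape)
  = well_formed c && ((B - claim (reported_rank_le rho) c)
      *m \col_i tape`_i == 0).
Proof.
move=> c; rewrite /verify run_bind /= run_bind /= run_bind /=.
have [e1 f1] := run_draw_matrix A mu 4 n 1 st tape.
set o1 := run A mu (draw_matrix n 4 n 1) st tape in e1 f1 *.
have eq_c : read_rep n rho (final o1) = c by apply: (frame_read_rep _ _ f1).
rewrite (tri_verify_after_draws op A mu (reported_rank_le rho) (final o1)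
  (drop (draws o1) tape)) eq_c e1.
congr (_ && (_ *m _ == 0)); apply/matrixP => i j.
by rewrite !mxE ord1 mul0n.
Qed.

(** An ill-formed certificate is never accepted. For a well-formed wrong one, acceptance forces the
    random vector to be annihilated by a nonzero row of the difference. *)
Lemma verify_prob (S : {fset F}) (rho : reported_rank n k) st :
  S != fset0 ->
  ~~ correct_certificate (reported_rank_le rho) B (read_rep n rho st) ->
  prob S n (fun t => leaf (run A mu (verify op rho) st t)) <= 1 / #|` S|%:R.
Proof.
move=> nS; rewrite correct_certificateE negb_and; set c := read_rep n rho st.
move=> wrong; apply: (prob_le (m := 1%N)) => //; rewrite mul1n.
under eq_tsum => t do rewrite verify_spec -/c.
case: (well_formed c) wrong => [|_] /=; last by rewrite tsum_const !muln0.
move=> ne; have [i nzi] : exists i, row i (B - claim (reported_rank_le rho) c) != 0.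
  apply/existsP; apply: contraR ne => /existsPn z.
  rewrite -subr_eq0; apply/eqP/row_matrixP => i; rewrite row0.
  by apply/eqP; have := z i; rewrite negbK.
set D := B - _ in nzi *.
pose a j := if insub j is Some j' then D i (j' : 'I_n) else 0.
have aE (j : 'I_n) : a j = D i j by rewrite /a valK.
have nza : exists2 j, (j < n)%N & a j != 0.
  have /rV0Pn [j] := nzi; rewrite mxE => nzj.
  by exists j; rewrite ?ltn_ord // aE.
have := count_linear (phi := (val : S -> F)) val_inj 0 nza.
apply: leq_trans; rewrite leq_mul2l; apply/orP; right; apply: leq_tsum => t _.
case: eqP => // /matrixP /(_ i 0); rewrite !mxE => e0.
suff -> : \sum_(j < n) a j * [seq val x | x <- t]`_j = 0 by rewrite eqxx.
by rewrite -[RHS]e0; apply: eq_bigr => j _; rewrite aE [X in _ = _ * X]mxE.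
Qed.

Lemma verify_complete (rho : reported_rank n k) st tape :
  correct_certificate (reported_rank_le rho) B (read_rep n rho st) ->
  leaf (run A mu (verify op rho) st tape).
Proof.
rewrite correct_certificateE verify_spec => /andP [->].
by rewrite -subr_eq0 => /eqP ->; rewrite mul0mx eqxx.
Qed.

End Guarantees.

Theorem theorem4p1 (op : displacement) :
  exists (check : forall n k : nat, prog n (option (reported_rank n k)))
         (verify : forall n k : nat, reported_rank n k -> prog n bool)
         (N : nat -> nat -> nat) (c : nat),
  forall (F : fieldType) (n k : nat) (S : {fset F}) (A : 'M[F]_n) (mu : nat),
  (0 < n)%N -> (0 < k)%N -> S != fset0 -> (n <= mu <= n * (2 * n + 1))%N ->
  let B := operator_matrix op A in
  let r := \rank B in
  [/\ Theta c (n * k) (N n k),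
      forall (st : state F) (t : (N n k).-tuple S),
        let o := run A mu (check n k) st [seq val s | s <- t] in
        [/\ draws o = N n k,
            Theta c (n * k ^ 2 + mu * k * up_log 2 n) (arith_ops o),
            Theta c (n * up_log 2 n) (bit_ops o)
          & check_succeeds B o || estimate_too_low B o],
      forall st : state F,
        prob S (N n k) (fun t => ~~ check_succeeds B (run A mu (check n k) st t))
          <= (minn r k + 1)%:R / #|` S|%:R
    & forall (rho : reported_rank n k) (st : state F),
        let accepts t := leaf (run A mu (verify n k rho) st t) in
        let correct :=
          correct_certificate (reported_rank_le rho) B (read_rep n rho st) in
        [/\ forall t : n.-tuple S,
              let o := run A mu (verify n k rho) st [seq val s | s <- t] in
              [/\ draws o = n,
                  Theta c (n * k + mu) (arith_ops o)
                & Theta c (n * up_log 2 n) (bit_ops o)],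
            correct -> forall t : n.-tuple S, accepts [seq val s | s <- t]
          & ~~ correct -> prob S n accepts <= 1 / #|` S|%:R]].
Proof.
(* The draws are the k + 1 columns of length n; 200 dominates every constant in the cost bounds. *)
exists (check op), (fun n k => @verify op n k), (fun n k => k.+1 * n)%N, 200%N.
move=> F n k S A mu n_gt0 k_gt0 nS /andP [_ le_mu] B r; split.
- by apply/andP; split; nia.
- move=> st t o; have [lo hi /andP [blo bhi] d] := check_costs op mu A k_gt0 st
    [seq val s | s <- t].
  rewrite -/o in lo hi blo bhi d; split=> //; first 1 last.
  + by apply/andP; split; lia.
  + have := check_spec op k mu A st [seq val s | s <- t].
    by rewrite -/o -/B; case: check_succeeds => //= /andP [].
  apply/andP; split; first by lia.
  apply: leq_trans hi _.
  have kk : (k <= k ^ 2)%N by rewrite expnS leq_pmulr ?expn_gt0 ?k_gt0.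
  have [n1|n_gt1] := leqP n 1.
    have {n1 n_gt0} n1 : n = 1%N by lia.
    (* For n = 1 the logarithm vanishes, and the black-box products are absorbed by k^2 because mu
       <= 3. *)
    rewrite n1 up_log1 in le_mu *; nia.
  have lg_gt0 : (0 < up_log 2 n)%N by rewrite up_log_gt0 n_gt1.
  have h : (k * mu <= mu * k * up_log 2 n)%N by rewrite [(k * mu)%N]mulnC leq_pmulr.
  have e : (k * up_log 2 n * mu = mu * k * up_log 2 n)%N by lia.
  by rewrite mulnDl e; lia.
- by move=> st; apply: check_prob.
move=> rho st accepts correct; split.
- move=> t o; have [/andP [alo ahi] /andP [blo bhi] d] :=
    verify_costs op mu A k_gt0 rho st [seq val s | s <- t].
  by rewrite -/o in alo ahi blo bhi d; split=> //; apply/andP; split; lia.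
- by move=> ok t; apply: verify_complete.
exact: verify_prob.
Qed.
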